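(* Let $|\psi\rangle$ be a core state of $M$ modes whose stellar polynomial $P_\psi\in\mathbb C[x_1,\dots,x_M]$ has degree $2$. Let $M'$ be the rank of the quadratic form given by the homogenization $P_\psi^h$ of $P_\psi$. Then the order of the Fock state projection in the preparation of $|\psi\rangle$ can be reduced to $M'-2$; that is, $|\psi\rangle$ can be prepared (up to a nonzero scalar) from the vacuum of the target and ancillary modes by photon additions and multiport interferometers followed by a projection of one ancillary mode onto the Fock state with $M'-2$ photons and, if $P_\psi$ is not homogeneous, by a subsequent displacement and vacuum projection on a second ancillary mode. Furthermore, if $P_\psi$ is homogeneous, this is the shortest scheme involving the given resources (photon additions, multiport interferometers and photon-number-resolving detection on one ancillary mode): no single-ancilla protocol preparing $|\psi\rangle$ uses fewer photon additions.
   Context: Modes and states. Each bosonic mode $j$ has creation/annihilation operators $\hat a_j^\dagger,\hat a_j$ with $[\hat a_j,\hat a_k^\dagger]=\delta_{jk}$; $|\mathbf 0\rangle$ is the multimode vacuum and $|n\rangle=(\hat a^\dagger)^n|0\rangle/\sqrt{n!}$. A core state of $M$ modes is a nonzero vector with finite support in the Fock basis, $|\psi\rangle=\sum_{\mathbf n}\psi_{\mathbf n}|\mathbf n\rangle$. Its stellar polynomial is $P_\psi(\mathbf x)=\sum_{\mathbf n}\frac{\psi_{\mathbf n}}{\sqrt{\mathbf n!}}\mathbf x^{\mathbf n}$, so that $|\psi\rangle=P_\psi(\hat a_1^\dagger,\dots,\hat a_M^\dagger)|\mathbf 0\rangle$. States are considered up to nonzero scalars. Homogenization: for $P=\sum_{\mathbf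 n}p_{\mathbf n}\mathbf x^{\mathbf n}$ of degree $d$, $P^h(y,\mathbf x)=\sum_{\mathbf n}p_{\mathbf n}y^{d-|\mathbf n|}\mathbf x^{\mathbf n}$ (if $P$ is homogeneous, $P^h=P$). A homogeneous polynomial of degree 2 is written $\mathbf y^TB\mathbf y$ with $B$ complex symmetric; its rank is the rank of $B$. Operations. Photon addition on mode $j$: $|\phi\rangle\mapsto\hat a_j^\dagger|\phi\rangle$. Multiport interferometer: a unitary on Fock space fixing the vacuum and acting by a unitary matrix $V$ as $\hat a_j^\dagger\mapsto\sum_k V_{kj}\hat a_k^\dagger$ (possibly on all modes, including ancillary ones). Projection of mode $j$ onto $n$ photons (the order of the projection is $n$): $|\phi\rangle\mapsto\langle n|_j|\phi\rangle$ (a vector of the remaining modes). Displacement on mode $j$: $\hat D_j(\beta)=\exp(\beta\hat a_j^\dagger-\beta^*\hat a_j)$, $\beta\in\mathbb C$. Single-ancilla protocol: start from the vacuum of the $M$ target modes and one ancillary mode, apply any finite sequence of photon additions and multiport interferometers on these $M+1$ modes, then project the ancillary mode onto a Fock state $|n\rangle$ for some $n\ge0$. Its length is its number of photon additions. *)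

(* Defs.v *)
From HB Require Import structures.
From mathcomp Require Import all_boot all_order all_algebra.
From mathcomp Require Import spectral.
From mathcomp Require Import freeg mpoly.

Set Implicit Arguments.
Unset Strict Implicit.
Unset Printing Implicit Defensive.

Import Order.TTheory GRing.Theory Num.Theory.
Local Open Scope ring_scope.

(* The vectors with finite support in the Fock basis of N modes: the basis
   vector |n> is << n >>, and fglift extends a map on the basis linearly.
   These vectors form a dense subspace of the Fock space that is stable under
   creation, annihilation and interferometers. *)
Notation fock C N := {freeg 'X_{1..N} / C}.

Section Fock.
Variable C : numClosedFieldType.

Definition vacuum N : fock C N := << 0%MM >>.

Definition creation N (j : 'I_N) : fock C N -> fock C N :=
  fglift (fun n : 'X_{1.._} => sqrtC (n j).+1%:R *: << (n + U_(j))%MM >>).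

(* The subtraction is truncated, but its coefficient is 0 when n j = 0. *)
Definition annihilation N (j : 'I_N) : fock C N -> fock C N :=
  fglift (fun n : 'X_{1.._} => sqrtC (n j)%:R *: << (n - U_(j))%MM >>).

Definition inner N (phi chi : fock C N) : C :=
  \sum_(n <- dom phi) (coeff n phi)^* * coeff n chi.

Definition stellar N : fock C N -> {mpoly C[N]} :=
  fglift (fun n : 'X_{1.._} => (sqrtC (\prod_i (n i)`!)%:R)^-1 *: 'X_[n]).

(* An isometric bijection of the dense subspace fock C N extends uniquely to a
   unitary of the Fock space.  The last condition is U a_j^dagger U^-1 =
   \sum_k V k j a_k^dagger. *)
Definition is_interferometer N (V : 'M[C]_N)
    (U : {linear fock C N -> fock C N}) : Prop :=
  [/\ V \is unitarymx,
      bijective U,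
      forall phi chi, inner (U phi) (U chi) = inner phi chi,
      U (vacuum N) = vacuum N
    & forall j phi,
        U (creation j phi) = \sum_k V k j *: creation k (U phi)].

(* [prepared l phi]: phi is obtained from the vacuum by interferometers and
   exactly l photon additions. *)
Inductive prepared N : nat -> fock C N -> Prop :=
| prepared_vacuum : prepared 0 (vacuum N)
| prepared_addition l phi j :
    prepared l phi -> prepared l.+1 (creation j phi)
| prepared_interferometer l phi V U :
    prepared l phi -> @is_interferometer N V U -> prepared l (U phi).

(* Occupation k in mode j, occupations m in the remaining modes. *)
Definition insert_mode N (j : 'I_N.+1) (k : nat) (m : 'X_{1..N}) :
    'X_{1..N.+1} :=
  [multinom (if unlift j i is Some i' then m i' else k) | i < N.+1].

Definition remove_mode N (j : 'I_N.+1) (m : 'X_{1..N.+1}) : 'X_{1..N} :=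
  [multinom m (fintype.lift j i) | i < N].

Definition projection N (j : 'I_N.+1) (k : nat) : fock C N.+1 -> fock C N :=
  fglift (fun n : 'X_{1.._} => if n j == k then << remove_mode j n >> else 0).

Definition displacement_generator N (beta : C) (j : 'I_N) (phi : fock C N) :
    fock C N :=
  beta *: creation j phi - beta^* *: annihilation j phi.

Definition displacement_partial N (beta : C) (j : 'I_N) (phi : fock C N)
    (K : nat) : fock C N :=
  \sum_(k < K) (k`!%:R)^-1 *: iter k (displacement_generator beta j) phi.

(* D_j(beta) phi need not have finite support; it is given by its amplitudes
   chi in the Fock basis, as the norm limit of the exponential series (phi is
   an analytic vector of the generator).  The squared norm of the difference is
   the supremum of its finite partial sums. *)
Definition is_displaced N (beta : C) (j : 'I_N) (phi : fock C N)
    (chi : 'X_{1..N} -> C) : Prop :=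
  forall e : C, 0 < e -> exists K0 : nat, forall K : nat, (K0 <= K)%N ->
    forall s : seq 'X_{1..N}, uniq s ->
      \sum_(n <- s) `|coeff n (displacement_partial beta j phi K) - chi n| ^+ 2
        <= e.

(* Mode 0 is the ancilla, the target modes are 1, ..., M. *)
Definition single_ancilla_protocol M (n l : nat) (psi : fock C M) : Prop :=
  exists phi : fock C M.+1, exists c : C,
    [/\ prepared l phi, c != 0 & projection ord0 n phi = c *: psi].

(* Mode 0 is the ancilla projected onto n photons; after this projection,
   mode 0 is the ancilla that is displaced and projected onto the vacuum. *)
Definition displaced_protocol M (n l : nat) (psi : fock C M) : Prop :=
  exists phi : fock C M.+2, exists beta : C, exists chi : 'X_{1..M.+1} -> C,
  exists c : C,
    [/\ prepared l phi,
        is_displaced beta ord0 (projection ord0 n phi) chi,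
        c != 0
      & forall m : 'X_{1..M}, chi (insert_mode ord0 0 m) = c * coeff m psi].

(* The homogenizing variable y is 'X_ord0; the degree of p is (msize p).-1. *)
Definition homogenization M (p : {mpoly C[M]}) : {mpoly C[M.+1]} :=
  \sum_(m <- msupp p)
    p@_m *: 'X_[insert_mode ord0 ((msize p).-1 - mdeg m) m].

Definition quadratic_form N (B : 'M[C]_N) : {mpoly C[N]} :=
  \sum_i \sum_j B i j *: ('X_i * 'X_j).

End Fock.

(* Main.v *)
Require Import Defs.
From HB Require Import structures.
From mathcomp Require Import all_boot all_order all_algebra.
From mathcomp Require Import spectral freeg mpoly complex reals.
From mathcomp Require boolp.
From mathcomp Require Import ring zify.

Set Implicit Arguments.
Unset Strict Implicit.
Unset Printing Implicit Defensive.

Import Order.TTheory GRing.Theory Num.Theory.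
Local Open Scope ring_scope.
(** By Bargmann's representation an interferometer acts on stellar polynomials
    by a unitary substitution and a photon addition multiplies them by a
    variable, so the states prepared with [l] additions are, up to scalars, the
    products of [l] linear forms.  Projecting the ancilla onto [n] photons
    extracts the coefficient of [X_0 ^ n] in [\prod_k (a_k X_0 + L_k)].  When the
    result is quadratic, [l = n + 2] and this coefficient is a quadratic form
    whose matrix has its rows in the span of the [L_k], hence of rank at most
    [l].  Conversely, with all [a_k = 1] it is the elementary symmetric form
    [e_2(L_1, ..., L_l)], which is nondegenerate in [l >= 2] variables, so every
    quadratic form of rank at most [l] arises.

    If [P] is not homogeneous, its homogenization is prepared in this way, the
    homogenizing variable being an additional mode: since
    [<0|D(beta) = exp(-|beta|^2/2) <0|exp(-beta^* a)], the vacuum projection after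
    [D(-1)] evaluates that variable at [1]. *)

(** * The Fock space and stellar polynomials *)

Section FreegLift.
Variables (C : comNzRingType) (K : choiceType).

HB.instance Definition _ (L : lmodType C) (f : K -> L) :=
  GRing.isAdditive.Build {freeg K / C} L (fglift f) (lift_is_additive f).

Lemma freegE (D : {freeg K / C}) : D = \sum_(z <- dom D) coeff z D *: << z >>.
Proof.
rewrite -[LHS]freeg_sumE; apply: eq_bigr => z _.
by apply/eqP/freeg_eqP => y; rewrite coeffZ !coeffU mul1r.
Qed.

Lemma freegZU (c : C) (z : K) : << c *g z >> = c *: << z >>.
Proof. by apply/eqP/freeg_eqP => y; rewrite coeffZ !coeffU mul1r. Qed.

Lemma fgliftE (L : lmodType C) (f : K -> L) (D : {freeg K / C}) :
  fglift f D = \sum_(z <- dom D) coeff z D *: f z.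
Proof.
rewrite -[in LHS](freeg_sumE D) raddf_sum; apply: eq_bigr => z _.
exact: liftU.
Qed.

Lemma fglift_scalable (L : lmodType C) (f : K -> L) : scalable (fglift f).
Proof.
move=> c D; rewrite -[in LHS](freeg_sumE D) scaler_sumr raddf_sum fgliftE.
rewrite scaler_sumr; apply: eq_bigr => z _ /=.
by rewrite freegZU scalerA -freegZU liftU scalerA.
Qed.

HB.instance Definition _ (L : lmodType C) (f : K -> L) :=
  GRing.isScalable.Build C {freeg K / C} L _ (fglift f) (fglift_scalable f).

Lemma fgliftU (L : lmodType C) (f : K -> L) z : fglift f << z >> = f z.
Proof. by rewrite liftU scale1r. Qed.

End FreegLift.

Section FockLinear.
Variable C : numClosedFieldType.

HB.instance Definition _ N (j : 'I_N) := GRing.Linear.copy (@creation C N j)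
  (fglift (fun n : 'X_{1.._} => sqrtC (n j).+1%:R *: << (n + U_(j))%MM >>)).
HB.instance Definition _ N (j : 'I_N) := GRing.Linear.copy (@annihilation C N j)
  (fglift (fun n : 'X_{1.._} => sqrtC (n j)%:R *: << (n - U_(j))%MM >>)).
HB.instance Definition _ N := GRing.Linear.copy (@stellar C N)
  (fglift (fun n : 'X_{1.._} => (sqrtC (\prod_i (n i)`!)%:R)^-1 *: 'X_[n])).
HB.instance Definition _ N j k := GRing.Linear.copy (@projection C N j k)
  (fglift (fun n : 'X_{1.._} => if n j == k then << remove_mode j n >> else 0)).

End FockLinear.

(** * Fock amplitudes of created and annihilated states *)

Section Coefficients.
Variable C : numClosedFieldType.

Definition mfact N (n : 'X_{1..N}) : C := (\prod_i (n i)`!)%:R.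

Lemma mfact_neq0 N (n : 'X_{1..N}) : mfact n != 0.
Proof.
by rewrite pnatr_eq0 -lt0n prodn_gt0 // => i; rewrite fact_gt0.
Qed.

Lemma sqrtC_mfact_neq0 N (n : 'X_{1..N}) : sqrtC (mfact n) != 0.
Proof. by rewrite sqrtC_eq0 mfact_neq0. Qed.

Lemma mfactDU N (n : 'X_{1..N}) j : mfact (n + U_(j))%MM = (n j).+1%:R * mfact n.
Proof.
rewrite /mfact (bigD1 j) //= [in RHS](bigD1 j) //= !natrM mulrA.
rewrite mnmDE mnm1E eqxx addn1 factS natrM; congr (_ * _%:R).
apply: eq_bigr => i ij; rewrite mnmDE mnm1E eq_sym (negPf ij) addn0 //.
Qed.

Lemma sqrtC_mfactDU N (n : 'X_{1..N}) j :
  sqrtC (mfact (n + U_(j))%MM) = sqrtC (n j).+1%:R * sqrtC (mfact n).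
Proof. by rewrite mfactDU sqrtCM // qualifE /= ler0n. Qed.

Lemma sqrtC_mfact0 N : sqrtC (mfact (0 : 'X_{1..N})%MM) = 1.
Proof. by rewrite /mfact big1 ?sqrtC1 // => i _; rewrite mnm0E. Qed.

Implicit Types N : nat.

Lemma coeff_stellar N (phi : fock C N) m :
  (stellar phi)@_m = coeff m phi / sqrtC (mfact m).
Proof.
rewrite {2}(freegE phi) !raddf_sum /= mulr_suml /stellar fgliftE raddf_sum /=.
apply: eq_bigr => n _; rewrite coeffZ !mcoeffZ mcoeffX coeffU mul1r -mulrA.
case: eqP => [->|_]; first by rewrite mulr1 mul1r.
by rewrite mul0r !mulr0.
Qed.

Lemma coeff_creation N (j : 'I_N) (phi : fock C N) n :
  coeff n (creation j phi) =
  if (0 < n j)%N then sqrtC (n j)%:R * coeff (n - U_(j))%MM phi else 0.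
Proof.
rewrite {2}(freegE phi) !raddf_sum /= /creation fgliftE raddf_sum /= mulr_sumr.
rewrite (eq_bigr (fun z : 'X_{1..N} => if (0 < n j)%N then sqrtC (n j)%:R *
   coeff (n - U_(j))%MM (coeff z phi *: << z >> : fock C N) else 0)); last first.
  move=> z _; rewrite !coeffZ !coeffU !mul1r; case: ifPn => nj.
    have nU : (U_(j) <= n)%MM by rewrite lep1mP -lt0n.
    rewrite -(eqm_add2r U_(j)%MM z) submK //.
    case: eqP => [E|_]; rewrite ?mulr0 // !mulr1 mulrC; congr (sqrtC _%:R * _).
    by rewrite -E mnmDE mnm1E eqxx addn1.
  case: eqP => [E|_]; rewrite ?mulr0 //.
  by move: nj; rewrite -E mnmDE mnm1E eqxx addn1.
by case: ifP => // _; rewrite big1_eq.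
Qed.

Lemma coeff_annihilation N (j : 'I_N) (phi : fock C N) n :
  coeff n (annihilation j phi) =
  sqrtC (n j).+1%:R * coeff (n + U_(j))%MM phi.
Proof.
rewrite {2}(freegE phi) !raddf_sum /= /annihilation fgliftE raddf_sum /= mulr_sumr.
apply: eq_bigr => z _; rewrite !coeffZ !coeffU !mul1r.
have [zj|zj] := eqVneq (z j) 0%N.
  rewrite zj sqrtC0 mul0r mulr0; case: eqP => [E|_]; rewrite ?mulr0 //.
  by move: zj; rewrite E mnmDE mnm1E eqxx addn1.
have Uz : (U_(j) <= z)%MM by rewrite lep1mP.
rewrite -(eqm_add2r U_(j)%MM) submK //.
case: eqP => [E|_]; rewrite ?mulr0 // !mulr1 mulrC; congr (sqrtC _%:R * _).
by rewrite E mnmDE mnm1E eqxx addn1.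
Qed.

End Coefficients.

(** * The stellar map as an isomorphism with polynomials *)

Section Stellar.
Variable C : numClosedFieldType.
Implicit Types N : nat.

Lemma mnm_ind N (P : 'X_{1..N} -> Prop) :
  P 0%MM -> (forall n j, P n -> P (n + U_(j))%MM) -> forall n, P n.
Proof.
move=> P0 PS n; have [d] := ubnP (mdeg n); elim: d n => // d IH n nd.
have [->//|n0] := eqVneq n 0%MM.
have /existsP[j nj] : [exists j, 0 < n j]%N.
  apply: contra_neqT n0 => /existsPn nn; apply/mnmP => i; rewrite mnm0E.
  by apply/eqP; rewrite -leqn0 leqNgt nn.
have Un : (U_(j) <= n)%MM by rewrite lep1mP -lt0n.
rewrite -(submK Un); apply/PS/IH.
by move: nd; rewrite -{1}(submK Un) mdegD mdeg1 addn1 ltnS.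
Qed.

Lemma creationU N (j : 'I_N) n :
  creation j << n >> = sqrtC (n j).+1%:R *: << (n + U_(j))%MM >> :> fock C N.
Proof. exact: fgliftU. Qed.

Lemma annihilationU N (j : 'I_N) n :
  annihilation j << n >> = sqrtC (n j)%:R *: << (n - U_(j))%MM >> :> fock C N.
Proof. exact: fgliftU. Qed.

Lemma sqrtC_nat_neq0 n : sqrtC n.+1%:R != 0 :> C.
Proof. by rewrite sqrtC_eq0 pnatr_eq0. Qed.

Lemma freeg_ind_span (K : choiceType) (P : {freeg K / C} -> Prop) :
  P 0 -> (forall c x y, P x -> P y -> P (c *: x + y)) ->
  (forall z, P << z >>) -> forall x, P x.
Proof.
move=> P0 PL PU x; rewrite (freegE x).
by elim: (dom x) => [|z s IH]; rewrite ?big_nil ?big_cons //; apply: PL.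
Qed.

(** The vacuum is cyclic for the creation operators: each [<< n >>] is a scalar multiple of iterated
    creations on it. A linear identity thus needs checking only on the vacuum and through one
    creation. *)
Lemma fock_ind N (P : fock C N -> Prop) :
  P (vacuum C N) -> (forall c x y, P x -> P y -> P (c *: x + y)) ->
  (forall j x, P x -> P (creation j x)) -> forall x, P x.
Proof.
move=> Pv PL PC.
have P0 : P 0 by have:= PL (-1) _ _ Pv Pv; rewrite scaleN1r addNr.
apply: freeg_ind_span => //; elim/mnm_ind => [//|n j Pn].
have:= PL (sqrtC (n j).+1%:R)^-1 _ _ (PC j _ Pn) P0.
by rewrite addr0 creationU scalerA mulVf ?scale1r // sqrtC_nat_neq0.
Qed.

Lemma stellarU N n :
  stellar << n >> = (sqrtC (mfact C n))^-1 *: 'X_[n] :> {mpoly C[N]}.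
Proof. exact: fgliftU. Qed.

Lemma stellar_vacuum N : stellar (vacuum C N) = 1.
Proof. by rewrite stellarU sqrtC_mfact0 invr1 scale1r mpolyX0. Qed.

(** The weight [sqrtC (n j).+1%:R] of the creation operator cancels against the change of the
    normalization [sqrtC (mfact C n)]. *)
Lemma stellar_creation N (j : 'I_N) (phi : fock C N) :
  stellar (creation j phi) = 'X_j * stellar phi.
Proof.
elim/freeg_ind_span: phi => [|c x y IHx IHy|n].
- by rewrite !linear0 mulr0.
- by rewrite !linearP /= IHx IHy mulrDr scalerAr.
rewrite creationU linearZ /= !stellarU scalerA sqrtC_mfactDU invfM mulrA.
by rewrite mulfV ?sqrtC_nat_neq0 // mul1r -scalerAr -mpolyXD addmC.
Qed.

Lemma stellar_annihilation N (j : 'I_N) (phi : fock C N) :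
  stellar (annihilation j phi) = mderiv j (stellar phi).
Proof.
apply/mpolyP => m; rewrite mcoeff_deriv !coeff_stellar coeff_annihilation.
rewrite sqrtC_mfactDU -[RHS]mulr_natr.
have := sqrtC_nat_neq0 (m j); have := sqrtC_mfact_neq0 C m.
have : sqrtC (m j).+1%:R ^+ 2 = (m j).+1%:R :> C by rewrite sqrtCK.
move: (sqrtC (m j).+1%:R) (sqrtC (mfact C m)) => s t <- t0 s0.
by field; apply/andP; split.
Qed.

Definition unstellar N (p : {mpoly C[N]}) : fock C N :=
  \sum_(m <- msupp p) (p@_m * sqrtC (mfact C m)) *: << m >>.

Lemma coeff_unstellar N (p : {mpoly C[N]}) m :
  coeff m (unstellar p) = p@_m * sqrtC (mfact C m).
Proof.
rewrite /unstellar raddf_sum [p in RHS]mpolyE raddf_sum /= mulr_suml.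
apply: eq_bigr => n _; rewrite coeffZ coeffU mcoeffZ mcoeffX mul1r.
by case: eqP => [->|_]; rewrite ?mulr1 ?mulr0 ?mul0r.
Qed.

Lemma unstellar_linear N : linear (@unstellar N).
Proof.
move=> c p q; apply/eqP/freeg_eqP => m.
by rewrite coeffD coeffZ !coeff_unstellar mcoeffD mcoeffZ mulrDl mulrA.
Qed.
HB.instance Definition _ N := GRing.isLinear.Build C {mpoly C[N]} (fock C N) _
  (@unstellar N) (@unstellar_linear N).

Lemma stellarK N : cancel (@stellar C N) (@unstellar N).
Proof.
move=> phi; apply/eqP/freeg_eqP => m.
by rewrite coeff_unstellar coeff_stellar divfK ?sqrtC_mfact_neq0.
Qed.

Lemma unstellarK N : cancel (@unstellar N) (@stellar C N).
Proof.
move=> p; apply/mpolyP => m.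
by rewrite coeff_stellar coeff_unstellar mulfK ?sqrtC_mfact_neq0.
Qed.

Lemma inner_sum N (phi chi : fock C N) (s : seq 'X_{1..N}) :
  uniq s -> {subset dom phi <= s} ->
  inner phi chi = \sum_(n <- s) (coeff n phi)^* * coeff n chi.
Proof.
move=> us sub; rewrite (bigID (mem (dom phi))) /= [X in _ + X]big1 => [|n].
  rewrite addr0 -big_filter; apply: perm_big.
  apply: uniq_perm; rewrite ?uniq_dom ?filter_uniq // => n.
  by rewrite mem_filter; case: (boolP (n \in dom phi)) => // /sub ->.
by move/coeff_outdom => ->; rewrite rmorph0 mul0r.
Qed.

Lemma inner_linearl N (chi : fock C N) c x y :
  inner (c *: x + y) chi = c^* * inner x chi + inner y chi.
Proof.
pose s := undup (dom x ++ dom y).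
have us : uniq s by exact: undup_uniq.
rewrite !(inner_sum _ us).
- rewrite mulr_sumr -big_split; apply: eq_bigr => n _ /=.
  by rewrite coeffD coeffZ rmorphD rmorphM mulrDl mulrA.
- by move=> n ny; rewrite mem_undup mem_cat ny orbT.
- by move=> n nx; rewrite mem_undup mem_cat nx.
move=> n /domD_subset; rewrite !mem_cat => /orP[/domZ_subset|] h;
  by rewrite mem_undup mem_cat h ?orbT.
Qed.

Lemma inner0l N (chi : fock C N) : inner 0 chi = 0.
Proof. by rewrite /inner dom0 big_nil. Qed.

Lemma inner_sumr N (phi : fock C N) I (r : seq I) (F : I -> fock C N) (c : I -> C) :
  inner phi (\sum_(i <- r) c i *: F i) = \sum_(i <- r) c i * inner phi (F i).
Proof.
rewrite /inner (eq_bigr _ (fun i _ => mulr_sumr _ _ _ _)) exchange_big.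
apply: eq_bigr => n _; rewrite raddf_sum mulr_sumr; apply: eq_bigr => i _.
by rewrite /= coeffZ mulrCA.
Qed.

Lemma inner_suml N (chi : fock C N) I (r : seq I) (F : I -> fock C N) (c : I -> C) :
  inner (\sum_(i <- r) c i *: F i) chi = \sum_(i <- r) (c i)^* * inner (F i) chi.
Proof.
by elim: r => [|i r IH]; rewrite ?big_nil ?inner0l // !big_cons inner_linearl IH.
Qed.

Lemma innerU N n (chi : fock C N) : inner << n >> chi = coeff n chi.
Proof. by rewrite /inner domU1 big_seq1 coeffU eqxx mulr1 rmorph1 mul1r. Qed.

Lemma sqrtC_nat_conj n : (sqrtC n%:R)^* = sqrtC n%:R :> C.
Proof. by apply/CrealP/ger0_real; rewrite sqrtC_ge0 ler0n. Qed.

Lemma inner_creation N (j : 'I_N) (phi chi : fock C N) :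
  inner (creation j phi) chi = inner phi (annihilation j chi).
Proof.
elim/freeg_ind_span: phi => [|c x y IHx IHy|n].
- by rewrite linear0 !inner0l.
- by rewrite linearP /= !inner_linearl IHx IHy.
rewrite creationU -[_ *: _]addr0 inner_linearl inner0l addr0 !innerU.
by rewrite coeff_annihilation sqrtC_nat_conj.
Qed.

End Stellar.

(** * Interferometers as linear substitutions *)

Section LinearForms.
Variable C : numClosedFieldType.
Implicit Types N K : nat.

Definition lform N (v : 'rV[C]_N) : {mpoly C[N]} := \sum_k v 0 k *: 'X_k.

Lemma lform_linear N : linear (@lform N).
Proof.
move=> c u v; rewrite /lform scaler_sumr -big_split; apply: eq_bigr => k _ /=.
by rewrite !mxE scalerDl scalerA.
Qed.
HB.instance Definition _ N :=
  GRing.isLinear.Build C 'rV[C]_N {mpoly C[N]} _ (@lform N) (@lform_linear N).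

Lemma lform_delta N (j : 'I_N) : lform (delta_mx 0 j) = 'X_j.
Proof.
rewrite /lform (bigD1 j) //= mxE !eqxx scale1r big1 ?addr0 // => k kj.
by rewrite mxE (negPf kj) andbF scale0r.
Qed.

(** Row [i] of [W] holds the image of ['X_i]; with coefficient vectors as rows, a linear form [v]
    goes to [v *m W], and successive substitutions multiply from left to right. *)
Definition subst N K (W : 'M[C]_(N, K)) : {mpoly C[N]} -> {mpoly C[K]} :=
  comp_mpoly [tuple lform (row i W) | i < N].
HB.instance Definition _ N K (W : 'M[C]_(N, K)) :=
  GRing.LRMorphism.copy (subst W) (comp_mpoly [tuple lform (row i W) | i < N]).

Lemma substX N K (W : 'M[C]_(N, K)) i : subst W 'X_i = lform (row i W).
Proof. by rewrite /subst comp_mpolyXU -tnth_nth tnth_mktuple. Qed.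

Lemma subst_lform N K (W : 'M[C]_(N, K)) v : subst W (lform v) = lform (v *m W).
Proof.
rewrite mulmx_sum_row !linear_sum; apply: eq_bigr => k _.
by rewrite !linearZ /= substX.
Qed.

Lemma mpoly_ind N (P : {mpoly C[N]} -> Prop) :
  P 1 -> (forall c p q, P p -> P q -> P (c *: p + q)) ->
  (forall j p, P p -> P ('X_j * p)) -> forall p, P p.
Proof.
move=> P1 PL PX p; rewrite -(unstellarK p); elim/fock_ind: (unstellar p).
- by rewrite stellar_vacuum.
- by move=> c x y Px Py; rewrite linearP; apply: PL.
by move=> j x Px; rewrite stellar_creation; apply: PX.
Qed.

Lemma substM N K L (W : 'M[C]_(N, K)) (W' : 'M[C]_(K, L)) p :
  subst W' (subst W p) = subst (W *m W') p.
Proof.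
elim/mpoly_ind: p => [|c p q IHp IHq|j p IHp].
- by rewrite !rmorph1.
- by rewrite !linearP /= IHp IHq.
by rewrite !rmorphM /= !substX subst_lform row_mul IHp.
Qed.

Lemma subst1 N (p : {mpoly C[N]}) : subst 1%:M p = p.
Proof.
elim/mpoly_ind: p => [|c p q IHp IHq|j p IHp].
- by rewrite rmorph1.
- by rewrite linearP /= IHp IHq.
by rewrite rmorphM /= substX rowE mulmx1 lform_delta IHp.
Qed.

Lemma mderivXU N (i j : 'I_N) : mderiv j 'X_i = (i == j)%:R :> {mpoly C[N]}.
Proof.
rewrite mderivX mnm1E; case: eqP => [->|_]; last by rewrite scale0r.
suff -> : (U_(j) - U_(j))%MM = 0%MM by rewrite mpolyX0 scale1r.
by apply/mnmP => k; rewrite mnmBE mnm0E subnn.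
Qed.

Lemma mderiv_lform N (v : 'rV[C]_N) j : mderiv j (lform v) = (v 0 j)%:MP.
Proof.
rewrite /lform raddf_sum /= (bigD1 j) //= big1 ?addr0 => [|k kj].
  by rewrite mderivZ mderivXU eqxx alg_mpolyC.
by rewrite mderivZ mderivXU (negPf kj) scaler0.
Qed.

Lemma mderiv_subst N K (W : 'M[C]_(N, K)) j p :
  mderiv j (subst W p) = \sum_i W i j *: subst W (mderiv i p).
Proof.
elim/mpoly_ind: p => [|c p q IHp IHq|k p IHp].
- rewrite rmorph1 -mpolyC1 mderivC big1 // => i _.
  by rewrite mderivC linear0 scaler0.
- rewrite !linearP /= IHp IHq scaler_sumr -big_split; apply: eq_bigr => i _ /=.
  by rewrite mderivD mderivZ linearP /= scalerDr !scalerA mulrC.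
rewrite rmorphM /= mderivM IHp substX mderiv_lform mxE [X in _ + X]mulr_sumr.
under [RHS]eq_bigr => i _.
  rewrite mderivM mderivXU rmorphD /= !rmorphM /= scalerDr substX (scalerAr _ (lform _)).
  over.
rewrite big_split /=; congr (_ + _).
rewrite [RHS](bigD1 k) //= [X in _ = _ + X]big1 ?addr0 => [|i ik].
  by rewrite eqxx rmorph1 mul1r mul_mpolyC.
by rewrite eq_sym (negPf ik) rmorph0 mul0r scaler0.
Qed.

End LinearForms.

Section Interferometers.
Variable C : numClosedFieldType.
Implicit Types N : nat.

(** Fixing the vacuum and conjugating the creation operators determine [U] by cyclicity. The image
    of ['X_j] is read in column [j] of [V], hence the transpose. *)
Lemma stellar_interferometer N (V : 'M[C]_N) U (phi : fock C N) :
  is_interferometer V U -> stellar (U phi) = subst V^T (stellar phi).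
Proof.
case=> _ _ _ Uv Uc; elim/fock_ind: phi => [|c x y IHx IHy|j x IHx].
- by rewrite Uv stellar_vacuum rmorph1.
- by rewrite !linearP /= IHx IHy.
rewrite Uc stellar_creation rmorphM /= substX linear_sum mulr_suml.
apply: eq_bigr => k _; rewrite linearZ /= stellar_creation IHx scalerAl.
by rewrite !mxE.
Qed.

Definition interferometer N (V : 'M[C]_N) : fock C N -> fock C N :=
  @unstellar C N \o (subst V^T \o @stellar C N).
HB.instance Definition _ N (V : 'M[C]_N) := GRing.Linear.copy (interferometer V)
  (@unstellar C N \o (subst V^T \o @stellar C N)).

Lemma stellar_interferometerE N (V : 'M[C]_N) phi :
  stellar (interferometer V phi) = subst V^T (stellar phi).
Proof. exact: unstellarK. Qed.

Lemma interferometer_creation N (V : 'M[C]_N) j phi :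
  interferometer V (creation j phi) =
  \sum_k V k j *: creation k (interferometer V phi).
Proof.
apply: (can_inj (@stellarK C N)); rewrite [RHS]linear_sum.
rewrite stellar_interferometerE stellar_creation rmorphM /= substX.
rewrite [LHS]mulr_suml; apply: eq_bigr => k _; rewrite linearZ /=.
by rewrite stellar_creation stellar_interferometerE !mxE scalerAl.
Qed.

Lemma interferometer_vacuum N (V : 'M[C]_N) :
  interferometer V (vacuum C N) = vacuum C N.
Proof.
apply: (can_inj (@stellarK C N)).
by rewrite stellar_interferometerE stellar_vacuum rmorph1.
Qed.

Lemma unitarymx_col N (V : 'M[C]_N) i j : V \is unitarymx ->
  \sum_k (V k j)^* * V^T i k = (i == j)%:R.
Proof.
rewrite -trmx_unitary => /unitarymxP/matrixP/(_ i j); rewrite !mxE => <-.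
by apply: eq_bigr => k _; rewrite !mxE mulrC.
Qed.

(** On polynomials this is the chain rule for [subst V^T]; orthonormality of the columns of [V] then
    collapses the double sum to the single index [j]. *)
Lemma interferometer_annihilation N (V : 'M[C]_N) j phi :
  V \is unitarymx ->
  interferometer V (annihilation j phi) =
  \sum_k (V k j)^* *: annihilation k (interferometer V phi).
Proof.
move=> Vu; apply: (can_inj (@stellarK C N)); rewrite [RHS]linear_sum.
rewrite stellar_interferometerE stellar_annihilation.
under eq_bigr => k _.
  rewrite linearZ /= stellar_annihilation stellar_interferometerE mderiv_subst scaler_sumr.
  over.
rewrite exchange_big /= [RHS](bigD1 j) //= [X in _ = _ + X]big1 => [|i ij].
  under eq_bigr do rewrite scalerA.
  by rewrite -scaler_suml unitarymx_col // eqxx scale1r addr0.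
under eq_bigr do rewrite scalerA.
by rewrite -scaler_suml unitarymx_col // (negPf ij) scale0r.
Qed.

(** Induction on [phi]: a creation on the left is moved to the right as an annihilation, on which
    the interferometer acts by the conjugate coefficients. *)
Lemma interferometer_inner N (V : 'M[C]_N) phi chi : V \is unitarymx ->
  inner (interferometer V phi) (interferometer V chi) = inner phi chi.
Proof.
move=> Vu; elim/fock_ind: phi chi => [chi|c x y IHx IHy chi|j x IHx chi].
(* Pairing with the vacuum extracts the vacuum amplitude of [chi], which is zero on both sides as
   soon as [chi] is a created state. *)
- rewrite interferometer_vacuum !innerU.
  rewrite -[LHS]mulr1 -[RHS]mulr1 -(sqrtC_mfact0 C N).
  elim/fock_ind: chi => [|c x y IHx IHy|j x _].
  + by rewrite interferometer_vacuum.
  + by rewrite linearP /= !coeffD !coeffZ !mulrDl -!mulrA IHx IHy.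
  rewrite interferometer_creation coeff_creation mnm0E raddf_sum big1 //= => k _.
  by rewrite coeffZ coeff_creation mnm0E mulr0.
- by rewrite linearP /= !inner_linearl IHx IHy.
rewrite interferometer_creation inner_suml inner_creation -IHx.
rewrite interferometer_annihilation // inner_sumr.
by apply: eq_bigr => k _; rewrite inner_creation.
Qed.

Lemma interferometerP N (V : 'M[C]_N) :
  V \is unitarymx -> is_interferometer V (interferometer V).
Proof.
move=> Vu; have Vi := unitarymx_unit Vu.
have Vti : V^T \in unitmx by rewrite unitmx_tr.
split=> //; last exact: interferometer_creation.
- exists (@unstellar C N \o (subst (invmx V^T) \o @stellar C N)) => phi /=.
    by rewrite stellar_interferometerE substM mulmxV // subst1 stellarK.
  apply: (can_inj (@stellarK C N)).
  by rewrite stellar_interferometerE unstellarK substM mulVmx // subst1.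
- by move=> phi chi; apply: interferometer_inner.
exact: interferometer_vacuum.
Qed.

(** Gram-Schmidt is applied to the matrix whose rows all equal [v]: its result is unitary even for
    dependent rows, and its first row spans [v]. *)
Lemma unitary_extension N (v : 'rV[C]_N.+1) : v != 0 ->
  exists (V : 'M[C]_N.+1) (a : C),
    [/\ V \is unitarymx, a != 0 & a *: row 0 V = v].
Proof.
move=> v0; pose A : 'M[C]_N.+1 := \matrix_i v.
have : (v <= row 0 (schmidt A))%MS.
  have /submx_trans := row_schmidt_sub A 0; rewrite rowK; apply.
  apply/sumsmx_subP => k; rewrite leqn0 => /eqP k0; rewrite genmxE.
  by have -> : k = 0 by apply/val_inj.
case/sub_rVP => a va; exists (schmidt A), a; split=> //.
  exact: schmidt_unitarymx.
by apply: contraNneq v0 => a0; rewrite va a0 scale0r.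
Qed.

Lemma prepared_stellar N l (phi : fock C N) : prepared l phi ->
  exists2 s : seq 'rV[C]_N, size s = l & stellar phi = \prod_(v <- s) lform v.
Proof.
elim=> [|{}l {}phi j _ [s <- E]|{}l {}phi V U _ [s <- E] UV].
- by exists [::]; rewrite // big_nil stellar_vacuum.
- exists (delta_mx 0 j :: s) => //.
  by rewrite big_cons lform_delta -E stellar_creation.
exists [seq v *m V^T | v <- s]; rewrite ?size_map //.
rewrite (stellar_interferometer _ UV). rewrite E rmorph_prod big_map.
by apply: eq_bigr => v _; rewrite /= subst_lform.
Qed.

(** Each factor is produced by adding a photon in mode 0 and then rotating ['X_0] to a multiple of
    the wanted form, which requires that form to be nonzero. *)
Lemma prepared_prod_lform N (s : seq 'rV[C]_N.+1) : all (predC1 0) s ->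
  exists (phi : fock C N.+1) (c : C),
    [/\ prepared (size s) phi, c != 0
      & \prod_(v <- s) lform v = c *: stellar phi].
Proof.
move: {2}(size s) (erefl (size s)) => l; elim: l s => [|l IH] [|v s] //=.
  move=> _ _; exists (vacuum C N.+1), 1; rewrite oner_neq0 big_nil.
  by rewrite stellar_vacuum scale1r; split=> //; apply: prepared_vacuum.
case=> sl /andP[v0 sN0]; have [V [a [Vu a0 Ev]]] := unitary_extension v0.
have Vi := unitarymx_unit Vu; have Vtu : V^T \is unitarymx by rewrite trmx_unitary.
(* The other forms are prepared beforehand in rotated coordinates, since the final interferometer
   acts on them as well. *)
have [||phi [c [pphi c0 E]]] := IH [seq u *m invmx V | u <- s].
- by rewrite size_map.
- apply/allP => _ /mapP[u /(allP sN0) /= u0 ->] /=.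
  by apply: contraNneq u0 => /(congr1 (mulmx^~ V)); rewrite mulmxKV // mul0mx => ->.
exists (interferometer V^T (creation 0 phi)), (a * c); split.
- apply: prepared_interferometer (interferometerP Vtu).
  by apply: prepared_addition; rewrite size_map in pphi.
- by rewrite mulf_neq0.
rewrite (stellar_interferometer _ (interferometerP Vtu)) trmxK big_cons.
rewrite stellar_creation rmorphM /= substX -Ev linearZ /= -scalerAl -scalerA.
congr (_ *: _); rewrite scalerAr -[c *: subst _ _]linearZ /= -E rmorph_prod big_map.
by congr (_ * _); apply: eq_bigr => u _; rewrite /= subst_lform mulmxKV.
Qed.

End Interferometers.

(** * Quadratic forms *)

Section QuadraticForms.
Variable C : numClosedFieldType.
Implicit Types N K : nat.

Lemma quadratic_form_linear N : linear (@quadratic_form C N).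
Proof.
move=> c A B; rewrite /quadratic_form scaler_sumr -big_split.
apply: eq_bigr => i _; rewrite scaler_sumr -big_split; apply: eq_bigr => j _ /=.
by rewrite !mxE scalerDl scalerA.
Qed.
HB.instance Definition _ N :=
  GRing.isLinear.Build C 'M[C]_N {mpoly C[N]} _ (@quadratic_form C N)
    (@quadratic_form_linear N).

Lemma quadratic_formE N (B : 'M[C]_N) :
  quadratic_form B = \sum_i 'X_i * lform (row i B).
Proof.
apply: eq_bigr => i _; rewrite mulr_sumr; apply: eq_bigr => j _.
by rewrite mxE scalerAr.
Qed.

Lemma quadratic_form_outer N (u v : 'rV[C]_N) :
  quadratic_form (u^T *m v) = lform u * lform v.
Proof.
rewrite quadratic_formE [lform u]/lform mulr_suml; apply: eq_bigr => i _.
have -> : row i (u^T *m v) = u 0 i *: v.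
  by apply/rowP => j; rewrite !mxE big_ord1 !mxE.
by rewrite linearZ /= -scalerAr -scalerAl.
Qed.

Lemma outer_rows N K (A : 'M[C]_(N, K)) (B : 'M[C]_(N, K)) :
  A^T *m B = \sum_i (row i A)^T *m row i B.
Proof.
apply/matrixP => i j; rewrite summxE mxE; apply: eq_bigr => k _.
by rewrite !mxE big_ord1 !mxE.
Qed.

Lemma subst_quadratic_form N K (W : 'M[C]_(N, K)) B :
  subst W (quadratic_form B) = quadratic_form (W^T *m B *m W).
Proof.
rewrite quadratic_formE raddf_sum /= -mulmxA outer_rows [RHS]linear_sum.
apply: eq_bigr => i _; rewrite rmorphM /= substX subst_lform.
by rewrite quadratic_form_outer row_mul.
Qed.

Lemma mderiv_quadratic_form N (B : 'M[C]_N) k :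
  mderiv k (quadratic_form B) = lform (row k (B + B^T)).
Proof.
rewrite quadratic_formE raddf_sum /=.
under eq_bigr do rewrite mderivM mderivXU mderiv_lform.
rewrite big_split /= linearD linearD /=; congr (_ + _).
  rewrite (bigD1 k) //= eqxx mul1r big1 ?addr0 // => i ik.
  by rewrite (negPf ik) mul0r.
by apply: eq_bigr => i _; rewrite !mxE mulrC mul_mpolyC.
Qed.

(** The second partial derivatives of the form of a symmetric matrix are twice its entries. *)
Lemma quadratic_form_sym_inj N (A B : 'M[C]_N) :
  A^T = A -> B^T = B -> quadratic_form A = quadratic_form B -> A = B.
Proof.
move=> As Bs AB; apply/matrixP => i j.
have := congr1 (fun p => (mderiv j (mderiv i p))@_0%MM) AB.
rewrite /= !mderiv_quadratic_form !mderiv_lform !mcoeffC eqxx !mulr1 As Bs.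
rewrite !mxE -!mulr2n => /eqP; rewrite -subr_eq0 -mulrnBl mulrn_eq0 /=.
by rewrite subr_eq0 => /eqP.
Qed.

(** If a diagonal entry is nonzero, a basis vector has nonzero value; otherwise [e_i + e_j] has the
    value [2 B_ij]. The value is normalized to 1 by a complex square root, the form being bilinear
    rather than Hermitian. *)
Lemma sym_form_neq0 N (B : 'M[C]_N) : B^T = B -> B != 0 ->
  exists v : 'rV[C]_N, (v *m B *m v^T) 0 0 = 1.
Proof.
move=> Bs B0; have [v vB] : exists v : 'rV[C]_N, (v *m B *m v^T) 0 0 != 0.
  have [/existsP[i ii]|/existsPn dB] := boolP [exists i, B i i != 0].
    exists (delta_mx 0 i); rewrite -rowE trmx_delta -colE !mxE //.
  have /matrix0Pn[i [j Bij]] := B0.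
  exists (delta_mx 0 i + delta_mx 0 j).
  rewrite linearD /= mulmxDl !mulmxDr !mulmxDl -!rowE !trmx_delta -!colE !mxE.
  have /eqP -> := negbNE (dB i); have /eqP -> := negbNE (dB j).
  have -> : B j i = B i j by rewrite -[in LHS]Bs mxE.
  by rewrite add0r addr0 -mulr2n mulrn_eq0.
set b := (v *m B *m v^T) 0 0 in vB; exists ((sqrtC b)^-1 *: v).
rewrite linearZ /= -scalemxAr -!scalemxAl scalerA mxE -/b -expr2 exprVn sqrtCK.
by rewrite mulVf.
Qed.

(* Subtracting the square of the linear form [v^T B] with [B(v, v) = 1] puts
   [v] into the kernel. *)
Lemma sum_of_squares N r (B : 'M[C]_N) : B^T = B -> (\rank B <= r)%N ->
  exists T : 'M[C]_(r, N), B = T^T *m T.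
Proof.
elim: r B => [|r IH] B Bs Br.
  exists 0; rewrite mulmx0; apply/eqP.
  by rewrite -mxrank_eq0 -leqn0.
have [->|B0] := eqVneq B 0; first by exists 0; rewrite mulmx0.
have [v vB] := sym_form_neq0 Bs B0; pose w := v *m B.
have wT : w^T = B *m v^T by rewrite trmx_mul Bs.
have [||T ET] := IH (B - w^T *m w).
- by rewrite linearB /= trmx_mul trmxK Bs.
- rewrite -ltnS; apply: leq_trans Br.
  have vk : v *m (B - w^T *m w) = 0.
    have e1 : v *m w^T = 1%:M by rewrite [LHS]mx11_scalar wT mulmxA vB.
    by rewrite mulmxBr (mulmxA v) e1 mul1mx subrr.
  (* The old kernel survives and [v] is new in it, so the rank drops by at least one. *)
  have kk : (kermx B < kermx (B - w^T *m w))%MS.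
    rewrite ltmxE; apply/andP; split.
      apply/sub_kermxP; rewrite mulmxBr mulmx_ker wT !mulmxA mulmx_ker.
      by rewrite !mul0mx subr0.
    apply/negP => /(submx_trans (introT sub_kermxP vk))/sub_kermxP vB0.
    move: vB; rewrite vB0 mul0mx mxE => /esym/eqP.
    by rewrite oner_eq0.
  have := rank_ltmx kk; rewrite !mxrank_ker.
  by have := rank_leq_row B; have := rank_leq_row (B - w^T *m w); lia.
exists (col_mx w T : 'M_(1 + r, N)).
by rewrite (tr_col_mx w T) (mul_row_col w^T) -ET addrC subrK.
Qed.

End QuadraticForms.

(** * Projection of the ancilla *)

Section AncillaSlices.
Variable C : numClosedFieldType.
Implicit Types N : nat.

Lemma insert_mode_at N (j : 'I_N.+1) k m : insert_mode j k m j = k.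
Proof. by rewrite mnmE unlift_none. Qed.

Lemma insert_mode_lift N (j : 'I_N.+1) k m i :
  insert_mode j k m (fintype.lift j i) = m i.
Proof. by rewrite mnmE liftK. Qed.

Lemma insert_mode_eq N (j : 'I_N.+1) k m n :
  (insert_mode j k m == n) = (n j == k) && (remove_mode j n == m).
Proof.
apply/eqP/andP => [<-|[/eqP nj /eqP <-]].
  split; first by rewrite insert_mode_at.
  by apply/eqP/mnmP => i; rewrite mnmE insert_mode_lift.
apply/mnmP => i; case: (unliftP j i) => [i'|] ->.
  by rewrite insert_mode_lift mnmE.
by rewrite insert_mode_at.
Qed.

Lemma coeff_projection N (j : 'I_N.+1) k (phi : fock C N.+1) m :
  coeff m (projection j k phi) = coeff (insert_mode j k m) phi.
Proof.
elim/freeg_ind_span: phi => [|c x y IHx IHy|n].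
- by rewrite linear0 !coeff0.
- by rewrite linearP /= !coeffD !coeffZ IHx IHy.
rewrite /projection fgliftU coeffU mul1r [n == _]eq_sym insert_mode_eq.
by case: eqP => _; rewrite ?coeff0 // coeffU mul1r.
Qed.

Lemma mfact_insert N k (m : 'X_{1..N}) :
  mfact C (insert_mode ord0 k m) = k`!%:R * mfact C m.
Proof.
rewrite /mfact big_ord_recl insert_mode_at natrM; congr (_ * _%:R).
by apply: eq_bigr => i _; rewrite insert_mode_lift.
Qed.

Lemma sqrtC_fact_neq0 n : sqrtC n`!%:R != 0 :> C.
Proof. by rewrite sqrtC_eq0 pnatr_eq0 -lt0n fact_gt0. Qed.

(* The coefficient of [X_0 ^ n], a polynomial in the remaining variables. *)
Definition slice N n (p : {mpoly C[N.+1]}) : {mpoly C[N]} :=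
  (sqrtC n`!%:R)^-1 *: stellar (projection ord0 n (unstellar p)).

Lemma stellar_projection N n (phi : fock C N.+1) :
  stellar (projection ord0 n phi) = sqrtC n`!%:R *: slice n (stellar phi).
Proof. by rewrite /slice stellarK scalerA mulfV ?sqrtC_fact_neq0 ?scale1r. Qed.

Lemma mcoeff_slice N n (p : {mpoly C[N.+1]}) m :
  (slice n p)@_m = p@_(insert_mode ord0 n m).
Proof.
rewrite mcoeffZ coeff_stellar coeff_projection coeff_unstellar mfact_insert.
rewrite sqrtCM ?qualifE /= ?ler0n //.
have := sqrtC_fact_neq0 n; have := sqrtC_mfact_neq0 C m.
move: (sqrtC _) (sqrtC _) => s t s0 t0.
by field; apply/andP; split.
Qed.

Lemma slice_linear N n : linear (@slice N n).
Proof.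
move=> c p q; apply/mpolyP => m.
by rewrite mcoeffD mcoeffZ !mcoeff_slice mcoeffD mcoeffZ.
Qed.
HB.instance Definition _ N n :=
  GRing.isLinear.Build C {mpoly C[N.+1]} {mpoly C[N]} _ (@slice N n)
    (@slice_linear N n).

Lemma mcoeffXM N (p : {mpoly C[N]}) j m :
  ('X_j * p)@_m = if (0 < m j)%N then p@_(m - U_(j))%MM else 0.
Proof.
case: ifPn => mj.
  have Um : (U_(j) <= m)%MM by rewrite lep1mP -lt0n.
  by rewrite -{1}(submK Um) mulrC addmC mcoeffMX.
rewrite [p]mpolyE mulr_sumr raddf_sum big1 //= => n _.
rewrite -scalerAr mcoeffZ -mpolyXD mcoeffX; case: eqP => [E|_].
  by move: mj; rewrite -E mnmDE mnm1E eqxx.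
by rewrite mulr0.
Qed.

Lemma slice0X0 N (p : {mpoly C[N.+1]}) : slice 0 ('X_ord0 * p) = 0.
Proof.
by apply/mpolyP => m; rewrite mcoeff_slice mcoeffXM insert_mode_at mcoeff0.
Qed.

Lemma sliceSX0 N n (p : {mpoly C[N.+1]}) :
  slice n.+1 ('X_ord0 * p) = slice n p.
Proof.
apply/mpolyP => m; rewrite !mcoeff_slice mcoeffXM insert_mode_at /=.
congr (p@_ _); apply/esym/eqP; rewrite insert_mode_eq mnmBE insert_mode_at mnm1E.
rewrite eqxx subn1 eqxx /=; apply/eqP/mnmP => i.
by rewrite mnmE mnmBE insert_mode_lift mnm1E subn0.
Qed.

Lemma slice_lift N n i (p : {mpoly C[N.+1]}) :
  slice n ('X_(fintype.lift ord0 i) * p) = 'X_i * slice n p.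
Proof.
apply/mpolyP => m; rewrite mcoeff_slice !mcoeffXM insert_mode_lift mcoeff_slice.
case: ifP => // mi; congr (p@_ _); apply/esym/eqP.
rewrite insert_mode_eq mnmBE insert_mode_at mnm1E subn0 eqxx /=.
apply/eqP/mnmP => k; rewrite mnmE !mnmBE insert_mode_lift !mnm1E.
by rewrite (inj_eq lift_inj).
Qed.

Definition tailv N (v : 'rV[C]_N.+1) : 'rV[C]_N :=
  \row_i v 0 (fintype.lift ord0 i).

Lemma lform_recl N (v : 'rV[C]_N.+1) : lform v =
  v 0 0 *: 'X_ord0 + \sum_i tailv v 0 i *: 'X_(fintype.lift ord0 i).
Proof.
by rewrite /lform big_ord_recl; congr (_ + _); apply: eq_bigr => i _; rewrite mxE.
Qed.

Lemma slice0_lformM N (v : 'rV[C]_N.+1) p :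
  slice 0 (lform v * p) = lform (tailv v) * slice 0 p.
Proof.
rewrite lform_recl mulrDl linearD /= -scalerAl linearZ /= slice0X0 scaler0 add0r.
rewrite mulr_suml linear_sum mulr_suml; apply: eq_bigr => i _.
by rewrite -!scalerAl linearZ /= slice_lift.
Qed.

(** The factor [X_0] of the new power comes either from [v] or from [p]. The recursions of [esym0],
    [esym1] and [esym2] follow this rule. *)
Lemma sliceS_lformM N n (v : 'rV[C]_N.+1) p :
  slice n.+1 (lform v * p) =
  v 0 0 *: slice n p + lform (tailv v) * slice n.+1 p.
Proof.
rewrite lform_recl mulrDl linearD /= -scalerAl linearZ /= sliceSX0.
rewrite mulr_suml linear_sum mulr_suml; congr (_ + _); apply: eq_bigr => i _.
by rewrite -!scalerAl linearZ /= slice_lift.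
Qed.

(* For linear forms [a_k X_0 + L_k], [esym0], [esym1] and [esym2] are the
   coefficients of [X_0 ^ l], [X_0 ^ (l - 1)] and [X_0 ^ (l - 2)] in their
   product, as a scalar, a linear form and a symmetric matrix. *)
Fixpoint esym0 N (s : seq 'rV[C]_N.+1) : C :=
  if s is v :: s' then v 0 0 * esym0 s' else 1.

Fixpoint esym1 N (s : seq 'rV[C]_N.+1) : 'rV[C]_N :=
  if s is v :: s' then v 0 0 *: esym1 s' + esym0 s' *: tailv v else 0.

Fixpoint esym2 N (s : seq 'rV[C]_N.+1) : 'M[C]_N :=
  if s is v :: s' then
    v 0 0 *: esym2 s' +
    2^-1 *: ((tailv v)^T *m esym1 s' + (esym1 s')^T *m tailv v)
  else 0.

Lemma slice_gt N (s : seq 'rV[C]_N.+1) n : (size s < n)%N ->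
  slice n (\prod_(v <- s) lform v) = 0.
Proof.
elim: s n => [|v s IH] [//|n] sn.
  apply/mpolyP => m; rewrite big_nil mcoeff_slice mcoeff1 mcoeff0.
  case: eqP => // /(congr1 (fun m : 'X_{1.. N.+1} => m ord0)).
  by rewrite insert_mode_at mnm0E.
by rewrite big_cons sliceS_lformM !IH ?scaler0 ?mulr0 ?addr0 // ltnW.
Qed.

Lemma slice_esym0 N (s : seq 'rV[C]_N.+1) :
  slice (size s) (\prod_(v <- s) lform v) = (esym0 s)%:MP.
Proof.
elim: s => [|v s IH].
  apply/mpolyP => m; rewrite big_nil mcoeff_slice mcoeff1 mcoeffC mul1r.
  by rewrite insert_mode_eq mnm0E eqxx; congr (_%:R); congr nat_of_bool;
     apply/eqP/eqP => [<-|->]; apply/mnmP => i; rewrite !mnmE.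
rewrite big_cons sliceS_lformM IH slice_gt // mulr0 addr0.
by rewrite -mul_mpolyC -mpolyCM.
Qed.

Lemma slice_esym1 N (s : seq 'rV[C]_N.+1) n : size s = n.+1 ->
  slice n (\prod_(v <- s) lform v) = lform (esym1 s).
Proof.
elim: s n => // v s IH n [sn]; rewrite big_cons linearD !linearZ /=.
have E0 := slice_esym0 s; rewrite sn in E0.
case: n sn E0 => [|n] sn E0.
  rewrite slice0_lformM E0 (size0nil sn) /= linear0 scaler0 add0r scale1r.
  by rewrite mulr1.
by rewrite sliceS_lformM (IH n) // E0 mulrC mul_mpolyC.
Qed.

Lemma slice_esym2 N (s : seq 'rV[C]_N.+1) n : size s = n.+2 ->
  slice n (\prod_(v <- s) lform v) = quadratic_form (esym2 s).
Proof.
elim: s n => // v s IH n [sn]; rewrite big_cons /= linearD !linearZ /= linearD /=.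
rewrite !quadratic_form_outer [lform (esym1 s) * _]mulrC -mulr2n -scaler_nat.
rewrite scalerA mulVf ?pnatr_eq0 // scale1r -(slice_esym1 sn).
case: n sn => [|n] sn; last by rewrite sliceS_lformM (IH _ sn).
(* For [n = 0] the list [s] has a single form, so [esym2 s] is zero and only the product of two
   tails remains. *)
rewrite slice0_lformM; move: sn; case: s {IH} => [|w s]; first by [].
case: s => [_ /=|x s]; last by [].
by rewrite trmx0 mulmx0 mul0mx !(addr0, scaler0, linear0, add0r).
Qed.

Lemma esym2_sym N (s : seq 'rV[C]_N.+1) : (esym2 s)^T = esym2 s.
Proof.
elim: s => [|v s IH] /=; first by rewrite trmx0.
rewrite linearD !linearZ linearD /= IH !trmx_mul !trmxK.
by rewrite [X in 2^-1 *: X]addrC.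
Qed.

Lemma rank_esym2 N (s : seq 'rV[C]_N.+1) : (\rank (esym2 s) <= size s)%N.
Proof.
(* [S] collects the tails, one row per form. The span of [esym1] is carried along because the
   recursion of [esym2] produces rows proportional to it. *)
suff [S [_ S2]] : exists S : 'M[C]_(size s, N),
    (esym1 s <= S)%MS /\ (esym2 s <= S)%MS.
  by apply: leq_trans (mxrankS S2) (rank_leq_row S).
elim: s => [|v s [S [S1 S2]]] /=; first by exists 0; rewrite !sub0mx.
exists (col_mx (tailv v) S : 'M_(1 + size s, N)).
have sv : (tailv v <= col_mx (tailv v) S)%MS by rewrite -addsmxE addsmxSl.
have sS : (S <= col_mx (tailv v) S)%MS by rewrite -addsmxE addsmxSr.
have s1 := submx_trans S1 sS; have s2 := submx_trans S2 sS.
split; first by rewrite addmx_sub ?scalemx_sub.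
by rewrite !(addmx_sub, scalemx_sub, mulmx_sub).
Qed.

End AncillaSlices.

(** * Single-ancilla protocols for quadratic forms *)

Section SingleAncilla.
Variable C : numClosedFieldType.
Implicit Types N M : nat.

Lemma esym0_ones N (s : seq 'rV[C]_N.+1) :
  (forall v, v \in s -> v 0 0 = 1) -> esym0 s = 1.
Proof.
elim: s => //= v s IH s1; rewrite IH ?mulr1 ?s1 ?mem_head // => u us.
by apply: s1; rewrite inE us orbT.
Qed.

Lemma esym1_ones N (s : seq 'rV[C]_N.+1) :
  (forall v, v \in s -> v 0 0 = 1) -> esym1 s = \sum_(v <- s) tailv v.
Proof.
elim: s => /= [|v s IH s1]; first by rewrite big_nil.
have s1' u : u \in s -> u 0 0 = 1 by move=> us; rewrite s1 // inE us orbT.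
by rewrite big_cons IH // esym0_ones // s1 ?mem_head // !scale1r addrC.
Qed.

(** Newton's identity [2 e_2 = e_1^2 - p_2] for linear forms, written with matrices. *)
Lemma esym2_ones N (s : seq 'rV[C]_N.+1) :
  (forall v, v \in s -> v 0 0 = 1) ->
  esym2 s = 2^-1 *: ((esym1 s)^T *m esym1 s
                     - \sum_(v <- s) (tailv v)^T *m tailv v).
Proof.
elim: s => /= [|v s IH s1]; first by rewrite big_nil mulmx0 subr0 scaler0.
have s1' u : u \in s -> u 0 0 = 1 by move=> us; rewrite s1 // inE us orbT.
rewrite big_cons IH // esym0_ones // s1 ?mem_head // !scale1r -scalerDr.
congr (_ *: _); rewrite [(_ + _)^T]linearD /= mulmxDl !mulmxDr.
set a := _ *m _; set b := _ *m _; set c := _ *m _; set d := _ *m _.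
set e := \sum_(_ <- _) _; apply/matrixP => i j; rewrite !mxE; ring.
Qed.

(* With [s] the sum of the [x_i], the forms [x_i + g s] satisfy
   [2 e_2 = (sum)^2 - (sum of squares) = (r (r - 1) g^2 + 2 (r - 1) g + 1) s^2
   - sum of the x_i^2], and [g] is chosen as a root of the coefficient of [s^2]. *)
Lemma exists_shift r : (1 < r)%N ->
  exists g : C, (1 + r%:R * g) ^+ 2 = 2 * g + r%:R * g ^+ 2.
Proof.
case: r => [|[|n]] // _; rewrite -(natr1 n.+1).
have m0 : n.+1%:R != 0 :> C by rewrite pnatr_eq0.
have m1 : n.+1%:R + 1 != 0 :> C by rewrite natr1 pnatr_eq0.
move: n.+1%:R m0 m1 => m m0 m1.
have s2 := sqrtCK (- m); set s := sqrtC (- m) in s2.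
(* With [r = m + 1] the equation reads [m (m + 1) g^2 + 2 m g + 1 = 0], whose reduced discriminant
   is [- m = s^2]. *)
exists ((s - m) / (m * (m + 1))).
apply/eqP; rewrite -subr_eq0; apply/eqP.
transitivity ((s ^+ 2 + m) / (m * (m + 1))); last by rewrite s2 addNr mul0r.
by field; rewrite m0 m1.
Qed.

(** [B] is a sum of [r] squares of forms [x_i], some possibly zero. After the shift by [g] times
    their sum, [e_2] equals [- 1/2] times this sum of squares. *)
Lemma preparable_quadratic_form N r (chi : fock C N) (B : 'M[C]_N) :
  (1 < r)%N -> B^T = B -> (\rank B <= r)%N -> stellar chi = quadratic_form B ->
  single_ancilla_protocol (r - 2) r chi.
Proof.
move=> r1 Bs Br chiB; have [T BT] := sum_of_squares Bs Br.
have [g Eg] := exists_shift r1; pose sg := \sum_i row i T.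
pose t i := row i T + g *: sg.
(* The ancilla coefficient 1 also guarantees that every form is nonzero, even when [t i]
   vanishes. *)
pose v i : 'rV[C]_N.+1 := \row_j if unlift ord0 j is Some k then t i 0 k else 1.
have tv i : tailv (v i) = row i T + g *: sg.
  by apply/rowP => k; rewrite [LHS]mxE [LHS]mxE liftK.
have v1 i : v i 0 0 = 1 by rewrite mxE unlift_none.
pose s := [seq v i | i <- enum 'I_r].
have s1 u : u \in s -> u 0 0 = 1 by case/mapP => i _ ->.
have sr : size s = r by rewrite size_map size_enum_ord.
have [|phi [c [pphi c0 Ephi]]] := @prepared_prod_lform C N s.
  apply/allP => u /s1 u1 /=; apply: contraTneq (oner_neq0 C) => u0.
  by rewrite -u1 u0 mxE eqxx.
have e1 : esym1 s = (1 + r%:R * g) *: sg.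
  rewrite esym1_ones // big_map big_enum /=.
  under eq_bigr do rewrite tv.
  rewrite big_split /= sumr_const card_ord scalerDl scale1r.
  by rewrite -scalerA scaler_nat.
have e2 : esym2 s = - 2^-1 *: B.
  rewrite esym2_ones // e1 big_map big_enum /= scaleNr -scalerN.
  congr (_ *: _); under eq_bigr do rewrite tv.
  (* The cross terms contribute [2 g] squares of [sg], because the rows of [T] add up to [sg]; the
     total multiple of this square cancels against [esym1 s] squared. *)
  have -> : \sum_i (row i T + g *: sg)^T *m (row i T + g *: sg) =
     B + ((2 * g + r%:R * g ^+ 2) *: (sg^T *m sg)).
    under eq_bigr => i _.
      rewrite [(_ + _)^T]linearD /= mulmxDl !mulmxDr.
      over.
    rewrite !big_split /= -outer_rows -BT -!mulmx_suml -!mulmx_sumr.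
    rewrite sumr_const card_ord -linear_sum -/sg !linearZ /= -!scalemxAl.
    rewrite -addrA; congr (_ + _); rewrite -scaler_nat -!scalemxAl !scalerA.
    by rewrite -!scalerDl; congr (_ *: _); ring.
  rewrite [(_ *: _)^T]linearZ /= -scalemxAl -scalemxAr scalerA -expr2 Eg.
  by rewrite opprD addrCA subrr addr0.
(* The three factors come from the normalization of the projected Fock state, the preparation of the
   product, and [e_2]. *)
exists phi, (sqrtC (r - 2)`!%:R * (c^-1 * - 2^-1)); split.
- by rewrite -sr.
- rewrite !mulf_neq0 ?sqrtC_fact_neq0 ?invr_eq0 ?oppr_eq0 //.
  by rewrite invr_eq0 pnatr_eq0.
apply: (can_inj (@stellarK C N)).
rewrite stellar_projection [RHS]linearZ /= -[RHS]scalerA; congr (_ *: _).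
have -> : stellar phi = c^-1 *: \prod_(u <- s) lform u.
  by rewrite Ephi scalerA mulVf // scale1r.
rewrite linearZ /= (@slice_esym2 _ _ _ (r - 2)) ?sr; last by lia.
by rewrite e2 linearZ /= -chiB scalerA.
Qed.

Lemma lform_homog N (v : 'rV[C]_N) : lform v \is 1.-homog.
Proof.
by apply: rpred_sum => i _; apply: rpredZ; rewrite dhomogX /= mdeg1.
Qed.

Lemma prod_lform_homog N (s : seq 'rV[C]_N) :
  \prod_(v <- s) lform v \is (size s).-homog.
Proof.
elim: s => [|v s IH]; first by rewrite big_nil dhomog1.
by rewrite big_cons; apply: (dhomogM (lform_homog v) IH).
Qed.

Lemma mdeg_insert N k (m : 'X_{1..N}) :
  mdeg (insert_mode ord0 k m) = (k + mdeg m)%N.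
Proof.
rewrite !mdegE big_ord_recl insert_mode_at; congr (_ + _)%N.
by apply: eq_bigr => i _; rewrite insert_mode_lift.
Qed.

(** The product of [l] forms is homogeneous of degree [l], so a monomial of degree 2 next to
    [X_0 ^ n] forces [l = n + 2]. By uniqueness of symmetric matrices [B] is then a multiple of
    [esym2], whose rank is bounded. *)
Lemma single_ancilla_length N n l (chi : fock C N) (B : 'M[C]_N) :
  B^T = B -> stellar chi = quadratic_form B -> stellar chi != 0 ->
  stellar chi \is 2.-homog -> single_ancilla_protocol n l chi ->
  l = n.+2 /\ (\rank B <= l)%N.
Proof.
move=> Bs chiB chi0 chi2 [phi [c [pphi c0 Ephi]]].
have [s sl Es] := prepared_stellar pphi.
have Ec : c *: stellar chi = sqrtC n`!%:R *: slice n (\prod_(v <- s) lform v).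
  by rewrite -Es -stellar_projection Ephi linearZ.
have ln : l = n.+2.
  have := mlead_supp chi0; set m := mlead _ => msup.
  have m2 : mdeg m = 2 := dhomogP _ _ _ chi2 _ msup.
  have : (c *: stellar chi)@_m != 0 by rewrite mcoeffZ mulf_neq0 // -mcoeff_msupp.
  rewrite Ec mcoeffZ mcoeff_slice mulf_eq0 negb_or => /andP[_].
  rewrite -mcoeff_msupp => /(dhomogP _ _ _ (prod_lform_homog s)) /=.
  by rewrite sl mdeg_insert m2 addn2 => ->.
split=> //; rewrite ln in sl *; rewrite -sl.
have : B = (c^-1 * sqrtC n`!%:R) *: esym2 s.
  apply: quadratic_form_sym_inj => //; first by rewrite linearZ /= esym2_sym.
  rewrite -chiB linearZ /= -(slice_esym2 sl) -scalerA -Ec scalerA mulVf //.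
  by rewrite scale1r.
by move=> ->; apply: leq_trans (rank_esym2 s); rewrite mxrankS // scalemx_sub.
Qed.

(** As a substitution it embeds the target variables beside the homogenizing one; its transpose sets
    the homogenizing variable to 0. *)
Definition shift_mx M : 'M[C]_(M, M.+1) :=
  \matrix_(i, j) (fintype.lift ord0 i == j)%:R.

Lemma row_shift_mx M (i : 'I_M) :
  row i (shift_mx M) = delta_mx 0 (fintype.lift ord0 i).
Proof. by apply/rowP => j; rewrite !mxE eqxx eq_sym. Qed.

Lemma shift_mxK M : shift_mx M *m (shift_mx M)^T = 1%:M.
Proof.
apply/matrixP => i j; rewrite !mxE (bigD1 (fintype.lift ord0 i)) //= big1.
  by rewrite !mxE eqxx mul1r addr0 (inj_eq lift_inj) eq_sym.
by move=> k; rewrite !mxE eq_sym => /negPf ->; rewrite mul0r.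
Qed.

Lemma mpolyX_insert M k (m : 'X_{1..M}) :
  'X_[insert_mode ord0 k m] =
  'X_ord0 ^+ k * subst (shift_mx M) 'X_[m] :> {mpoly C[M.+1]}.
Proof.
rewrite [LHS]mpolyXE_id big_ord_recl insert_mode_at; congr (_ * _).
rewrite /subst comp_mpolyX; apply: eq_bigr => i _.
by rewrite insert_mode_lift tnth_mktuple row_shift_mx lform_delta.
Qed.

Lemma homogenization_homog M (p : {mpoly C[M]}) : p \is homog mdeg ->
  homogenization p = subst (shift_mx M) p.
Proof.
rewrite homog_msize => /dhomogP ph; rewrite [in RHS](mpolyE p) raddf_sum /=.
apply: eq_big_seq => m /ph <-.
by rewrite linearZ /= mpolyX_insert subnn expr0 mul1r.
Qed.

End SingleAncilla.

(** * Displacement and vacuum projection *)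

Section DisplacementAlgebra.
Variables (C : numClosedFieldType) (N : nat) (j : 'I_N).
Implicit Types (phi : fock C N) (m n : 'X_{1..N}).

Local Notation G := (@displacement_generator C N (-1) j).
Local Notation S := (fun phi K => @displacement_partial C N (-1) j phi K).

Lemma generatorE phi : G phi = annihilation j phi - creation j phi.
Proof. by rewrite /displacement_generator rmorphN rmorph1 !scaleN1r opprK addrC. Qed.

Lemma generator_linear : linear G.
Proof.
move=> c x y; rewrite !generatorE [annihilation j _]linearP [creation j _]linearP /=.
by rewrite opprD addrACA scalerBr.
Qed.
HB.instance Definition _ := GRing.isLinear.Build C (fock C N) (fock C N) _
  (G : _ -> _) generator_linear.

Lemma iter_generator_linear k : linear (iter k G).
Proof. by elim: k => // k IH c x y; rewrite /= IH linearP. Qed.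

Lemma iter_generatorN k phi : iter k G (- phi) = - iter k G phi.
Proof. by elim: k => //= k ->; rewrite linearN. Qed.

Lemma displacement_partial_linear K : linear (S^~ K).
Proof.
move=> c x y; rewrite /displacement_partial scaler_sumr -big_split.
apply: eq_bigr => k _ /=; rewrite iter_generator_linear scalerDr !scalerA.
by rewrite [c * _]mulrC.
Qed.

Lemma displacement_partialS phi K : S phi K.+1 = S phi K + (K`!%:R)^-1 *: iter K G phi.
Proof. exact: big_ord_recr. Qed.

Lemma annihilation_creation phi :
  annihilation j (creation j phi) = creation j (annihilation j phi) + phi.
Proof.
apply: (can_inj (@stellarK C N)); rewrite linearD /= stellar_annihilation.
rewrite !stellar_creation mderivM mderivXU eqxx mul1r stellar_annihilation.
exact: addrC.
Qed.

Lemma generator_creation phi : G (creation j phi) = creation j (G phi) + phi.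
Proof.
by rewrite !generatorE annihilation_creation [creation j (_ - _)]linearB /= addrAC. Qed.

(** The commutator of [G] with the creation operator is the identity, so it acts like a derivation
    on powers of [G]. For [k = 0] the truncated [k.-1] has coefficient 0. *)
Lemma iter_generator_creation k phi :
  iter k G (creation j phi) =
  creation j (iter k G phi) + k%:R *: iter k.-1 G phi.
Proof.
elim: k => [|k IH] /=; first by rewrite scale0r addr0.
rewrite IH linearD linearZ /= generator_creation -addrA; congr (_ + _).
case: k {IH} => [|k] /=; first by rewrite scale0r addr0 scale1r.
by rewrite -[k.+2%:R]natr1 scalerDl scale1r addrC.
Qed.

Lemma coeff_creation0 m phi : m j = 0%N -> coeff m (creation j phi) = 0.
Proof. by move=> mj; rewrite coeff_creation mj. Qed.

(** A created state has no amplitude where mode [j] is empty, so only the commutator term survives,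
    and [k / k!] is [1 / (k - 1)!]. Dropping one creation therefore costs exactly one term of the
    series. *)
Lemma coeff_partial_creation m phi K : m j = 0%N ->
  coeff m (S (creation j phi) K.+1) = coeff m (S phi K).
Proof.
move=> mj; rewrite /displacement_partial big_ord_recl coeffD coeffZ /=.
rewrite coeff_creation0 // mulr0 add0r !raddf_sum; apply: eq_bigr => k _ /=.
rewrite /bump add1n add0n !coeffZ -iterS iter_generator_creation coeffD.
rewrite coeff_creation0 // add0r coeffZ /= factS natrM invfM mulrA.
by rewrite [_ / _ * _]mulrAC mulVf ?mul1r // pnatr_eq0.
Qed.

Lemma coeff_partial_creations m phi d (K : nat) : m j = 0%N ->
  coeff m (S (iter d (creation j) phi) (d + K)%N) = coeff m (S phi K).
Proof.
move=> mj; elim: d => [|d IH]; first by rewrite add0n.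
by rewrite addSn iterS coeff_partial_creation.
Qed.

End DisplacementAlgebra.

(** * The vacuum amplitude of the displacement *)

Section VacuumAmplitude.
Variable C : numClosedFieldType.

(* [<0|G^k|0> / k!] for the generator [G = a - a^dagger] of [D(-1)]. *)
Fixpoint vacuum_term k : C :=
  match k with
  | 0 => 1
  | k'.+1 => if k' is k''.+1 then - vacuum_term k'' / k%:R else 0
  end.

(** These are the partial sums of the series of [exp(-1/2)], of which only the nonzero limit
    matters. *)
Definition vacuum_amplitude K : C := \sum_(k < K) vacuum_term k.

Lemma vacuum_termSS k : vacuum_term k.+2 = - vacuum_term k / k.+2%:R.
Proof. by []. Qed.

(** On an empty mode [G] reduces to minus the creation operator; commuting this creation to the left
    through the remaining powers of [G] lowers [k] by two. *)
Lemma coeff_iter_generator N (j : 'I_N) (m n : 'X_{1..N}) k :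
  m j = 0%N -> n j = 0%N ->
  (k`!%:R)^-1 * coeff m (iter k (displacement_generator (-1) j) << n >>) =
  vacuum_term k * (n == m)%:R.
Proof.
move=> mj nj; have annn : annihilation j << n >> = 0 :> fock C N.
  by rewrite annihilationU nj sqrtC0 scale0r.
have GE : displacement_generator (-1) j << n >> =
    - creation j << n >> :> fock C N.
  by rewrite generatorE annn sub0r.
elim/ltn_ind: k => -[|[|k]] IH.
- by rewrite /= coeffU fact0 invr1 !mul1r.
- rewrite iterSr GE /= coeffN coeff_creation0 //.
  by rewrite oppr0 mulr0 mul0r.
rewrite iterSr GE iter_generatorN coeffN iter_generator_creation coeffD.
rewrite coeff_creation0 // add0r coeffZ /= mulrAC mulNr -IH; last first.
  by rewrite ltnS ltnW.
rewrite !factS !natrM.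
have : k.+2%:R != 0 :> C by rewrite pnatr_eq0.
have : k.+1%:R != 0 :> C by rewrite pnatr_eq0.
have : k`!%:R != 0 :> C by rewrite pnatr_eq0 -lt0n fact_gt0.
move: (coeff _ _) k.+2%:R k.+1%:R k`!%:R => x a b f f0 b0 a0.
by field; rewrite a0 b0 f0.
Qed.

(** The left-hand side does not increase with [K]: the term two steps later is at most a quarter of
    the present one, and [4/3] solves [x = 1 + x / 4]. At [K = 0] it equals [2/3]. *)
Lemma vacuum_amplitude_bound K :
  `|vacuum_amplitude K.+2 - 1|
  + 4%:R / 3%:R * (`|vacuum_term K.+2| + `|vacuum_term K.+3|) <= 2%:R / 3%:R.
Proof.
elim: K => [|K IH].
  rewrite /vacuum_amplitude !big_ord_recl big_ord0 /= !addr0 subrr normr0 add0r.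
  rewrite oppr0 mul0r normr0 addr0 normrM normrN normr1 mul1r normfV.
  by rewrite normr_nat; rewrite le_eqVlt; apply/predU1l; field.
apply: le_trans IH; rewrite (vacuum_termSS K.+2).
have -> : vacuum_amplitude K.+3 = vacuum_amplitude K.+2 + vacuum_term K.+2.
  exact: big_ord_recr.
move: (vacuum_amplitude _) (vacuum_term K.+2) (vacuum_term K.+3) => w a b.
have h1 : `|w + a - 1| <= `|w - 1| + `|a| by rewrite addrAC ler_normD.
have h2 : `|- a / K.+4%:R| <= `|a| / 4%:R.
  rewrite normrM normrN normfV normr_nat ler_wpM2l // lef_pV2 ?posrE ?ltr0n //.
  by rewrite ler_nat.
have h3 : 0 <= 4%:R / 3%:R :> C by rewrite divr_ge0 ?ler0n.
apply: le_trans (lerD h1 (ler_wpM2l h3 (lerD (lexx `|b|) h2))) _.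
by rewrite le_eqVlt; apply/predU1l; field.
Qed.

Lemma vacuum_amplitude_ge K : 3%:R^-1 <= `|vacuum_amplitude K.+2|.
Proof.
have h0 : 0 <= 4%:R / 3%:R * (`|vacuum_term K.+2| + `|vacuum_term K.+3|).
  by rewrite mulr_ge0 ?divr_ge0 ?ler0n ?addr_ge0.
have h : `|1 - vacuum_amplitude K.+2| <= 2%:R / 3%:R.
  by rewrite distrC; apply: le_trans (vacuum_amplitude_bound K); rewrite lerDl.
have -> : 3%:R^-1 = 1 - 2%:R / 3%:R :> C by field.
rewrite lerBlDr; apply: le_trans (lerD (lexx _) h).
by apply: le_trans (ler_normD _ _); rewrite addrC subrK normr1.
Qed.

Lemma coeff_partialU N (j : 'I_N) (m n : 'X_{1..N}) K :
  m j = 0%N -> n j = 0%N ->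
  coeff m (displacement_partial (-1) j << n >> K) =
  vacuum_amplitude K * (n == m)%:R.
Proof.
move=> mj nj; rewrite raddf_sum mulr_suml; apply: eq_bigr => k _ /=.
by rewrite coeffZ coeff_iter_generator.
Qed.

End VacuumAmplitude.

(** * Norm bounds for the exponential series *)

Section ExponentialBounds.
Variables (C : numClosedFieldType) (N : nat) (j : 'I_N).
Implicit Types (phi : fock C N) (b : C).

Local Notation G := (@displacement_generator C N (-1) j).

(* The l1 norm dominates the l2 norm of [is_displaced] and is propagated by the
   generator without any Hilbert space argument; the loss is controlled by the
   largest occupation [d] of mode [j]. *)
Definition l1_bounded (d : nat) b phi :=
  (forall n : 'X_{1..N}, (d < n j)%N -> coeff n phi = 0) /\
  (forall s : seq 'X_{1..N}, uniq s -> \sum_(n <- s) `|coeff n phi| <= b).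

Lemma l1_bounded_ge0 d b phi : l1_bounded d b phi -> 0 <= b.
Proof. by case=> _ /(_ [::] isT); rewrite big_nil. Qed.

Lemma l1_bounded_weaken d d' b b' phi : (d <= d')%N -> b <= b' ->
  l1_bounded d b phi -> l1_bounded d' b' phi.
Proof.
move=> dd' bb' [h1 h2]; split=> [n nd|s us].
  by apply: h1; apply: leq_ltn_trans nd.
exact: le_trans (h2 s us) bb'.
Qed.

Lemma l1_bounded0 d : l1_bounded d 0 0.
Proof.
split=> [n _|s _]; first exact: coeff0.
by rewrite big1 // => n _; rewrite coeff0 normr0.
Qed.

Lemma l1_boundedD d b b' phi chi : l1_bounded d b phi -> l1_bounded d b' chi ->
  l1_bounded d (b + b') (phi + chi).
Proof.
move=> [h1 h2] [h1' h2']; split=> [n nd|s us].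
  by rewrite coeffD h1 // h1' // addr0.
apply: le_trans (lerD (h2 s us) (h2' s us)); rewrite -big_split.
by apply: ler_sum => n _; rewrite coeffD ler_normD.
Qed.

Lemma l1_boundedZ d b c phi : l1_bounded d b phi ->
  l1_bounded d (`|c| * b) (c *: phi).
Proof.
move=> [h1 h2]; split=> [n nd|s us]; first by rewrite coeffZ h1 // mulr0.
under eq_bigr do rewrite coeffZ normrM.
by rewrite -mulr_sumr ler_wpM2l // h2.
Qed.

Lemma l1_bounded_exists phi : exists d b, l1_bounded d b phi.
Proof.
elim/freeg_ind_span: phi => [|c x y [d [b hx]] [d' [b' hy]]|m].
- by exists 0, 0; apply: l1_bounded0.
- exists (maxn d d'), (`|c| * b + b'); apply: l1_boundedD.
    by apply/l1_boundedZ/(l1_bounded_weaken (leq_maxl _ _) (lexx _) hx).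
  exact: (l1_bounded_weaken (leq_maxr _ _) (lexx _) hy).
exists (m j), 1; split=> [n nm|s us].
  by rewrite coeffU; case: eqP nm => [->|]; rewrite ?ltnn ?mulr0.
have [ms|ms] := boolP (m \in s); last first.
  rewrite big_seq big1 // => n ns; rewrite coeffU mul1r.
  by case: eqP ns ms => [->->|]; rewrite ?normr0.
rewrite (bigD1_seq m) //= coeffU eqxx mulr1 normr1 big1 ?addr0 // => n nm.
by rewrite coeffU eq_sym (negPf nm) mulr0 normr0.
Qed.

Lemma sqrtC_nat_le m n : (m <= n)%N -> sqrtC m%:R <= sqrtC n%:R :> C.
Proof. by move=> mn; rewrite ler_sqrtC ?qualifE /= ?ler0n // ler_nat. Qed.

(** Distinct basis vectors go to multiples of distinct basis vectors, with weights at most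
    [sqrtC d.+1%:R]. *)
Lemma l1_bounded_creation d b phi : l1_bounded d b phi ->
  l1_bounded d.+1 (sqrtC d.+1%:R * b) (creation j phi).
Proof.
move=> [h1 h2]; split=> [n nd|s us].
  rewrite coeff_creation; case: ifP => // _.
  by rewrite h1 ?mulr0 // mnmBE mnm1E eqxx subn1 -ltnS prednK // (leq_trans _ nd).
pose s' := [seq (n - U_(j))%MM | n : 'X_{1..N} <- s & (0 < n j)%N].
have us' : uniq s'.
  rewrite map_inj_in_uniq ?filter_uniq // => n n'; rewrite !mem_filter.
  move=> /andP[nj _] /andP[nj' _] E.
  have Un : (U_(j) <= n)%MM by rewrite lep1mP -lt0n.
  have Un' : (U_(j) <= n')%MM by rewrite lep1mP -lt0n.
  by rewrite -(submK Un) E submK.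
apply: le_trans (ler_wpM2l _ (h2 _ us')); last by rewrite sqrtC_ge0 ler0n.
rewrite big_map big_filter mulr_sumr big_mkcond [X in _ <= X]big_mkcond.
apply: ler_sum => n _; rewrite coeff_creation; case: ifP => nj; last first.
  by rewrite normr0.
rewrite normrM ger0_norm ?sqrtC_ge0 ?ler0n //.
have [nd|nd] := leqP (n j) d.+1; first by rewrite ler_wpM2r // sqrtC_nat_le.
by rewrite h1 ?normr0 ?mulr0 // mnmBE mnm1E eqxx subn1 -ltnS prednK.
Qed.

Lemma l1_bounded_annihilation d b phi : l1_bounded d b phi ->
  l1_bounded d.+1 (sqrtC d.+1%:R * b) (annihilation j phi).
Proof.
move=> [h1 h2]; have hU (n : 'X_{1..N}) : ((n + U_(j))%MM j = (n j).+1)%N.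
  by rewrite mnmDE mnm1E eqxx addn1.
split=> [n nd|s us].
  by rewrite coeff_annihilation h1 ?mulr0 // hU ltnS ltnW // ltnW.
have us' : uniq [seq (n + U_(j))%MM | n : 'X_{1..N} <- s].
  by rewrite map_inj_uniq // => n n' /eqP; rewrite eqm_add2r => /eqP.
apply: le_trans (ler_wpM2l _ (h2 _ us')); last by rewrite sqrtC_ge0 ler0n.
rewrite big_map mulr_sumr; apply: ler_sum => n _.
rewrite coeff_annihilation normrM ger0_norm ?sqrtC_ge0 ?ler0n //.
have [nd|nd] := leqP (n j).+1 d.+1; first by rewrite ler_wpM2r // sqrtC_nat_le.
by rewrite h1 ?normr0 ?mulr0 // hU ltnW.
Qed.

Lemma l1_bounded_generator d b phi : l1_bounded d b phi ->
  l1_bounded d.+1 (2%:R * sqrtC d.+1%:R * b) (G phi).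
Proof.
move=> h; rewrite generatorE -scaleN1r.
have -> : 2%:R * sqrtC d.+1%:R * b =
    sqrtC d.+1%:R * b + `|-1| * (sqrtC d.+1%:R * b).
  by rewrite normrN1 mul1r -mulrA mulr_natl mulr2n.
apply: l1_boundedD (l1_bounded_annihilation h) _.
exact: l1_boundedZ (l1_bounded_creation h).
Qed.

Definition exp_term phi k := (k`!%:R)^-1 *: iter k G phi.

Lemma exp_termS phi k : exp_term phi k.+1 = (k.+1%:R)^-1 *: G (exp_term phi k).
Proof. by rewrite /exp_term linearZ /= scalerA factS natrM invfM. Qed.

(** This bounds the ratio of successive exponential terms: each application of [G] costs a square
    root of the occupation, while the factorial gains a full factor. *)
Lemma ratio_le_half d k : (16 * d + 32 <= k)%N ->
  (k.+1%:R)^-1 * (2%:R * sqrtC (d + k).+1%:R) <= 2%:R^-1 :> C.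
Proof.
move=> dk; have k0 : 0 <= k.+1%:R / 4%:R :> C by rewrite divr_ge0 ?ler0n.
(* After squaring, the claim is [16 (d + k + 1) <= (k + 1)^2]. *)
have h : sqrtC (d + k).+1%:R <= k.+1%:R / 4%:R :> C.
  rewrite -(sqrCK k0) ler_sqrtC ?qualifE /= ?ler0n ?exprn_ge0 //.
  rewrite expr_div_n ler_pdivlMr -?natrX -?natrM ?ler_nat ?ltr0n //.
  by rewrite expnS; nia.
apply: le_trans (ler_wpM2l _ (ler_wpM2l _ h)) _; rewrite ?invr_ge0 ?ler0n //.
have : k.+1%:R != 0 :> C by rewrite pnatr_eq0.
by move: k.+1%:R => x x0; rewrite le_eqVlt; apply/predU1l; field.
Qed.

Lemma exp_term_l1 phi d b : l1_bounded d b phi ->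
  forall k, exists b', l1_bounded (d + k) b' (exp_term phi k).
Proof.
move=> h; elim=> [|k [b' IH]].
  by exists b; rewrite addn0 /exp_term fact0 invr1 scale1r.
exists (`|(k.+1%:R)^-1| * (2%:R * sqrtC (d + k).+1%:R * b')).
by rewrite exp_termS addnS; apply/l1_boundedZ/l1_bounded_generator.
Qed.

Lemma exp_term_geometric phi : exists (k0 : nat) (b : C), forall i,
  exists d, l1_bounded d (b / 2%:R ^+ i) (exp_term phi (k0 + i)).
Proof.
have [d [b h]] := l1_bounded_exists phi; pose k0 := (16 * d + 32)%N.
have [b' hb'] := exp_term_l1 h k0; exists k0, b' => i.
exists (d + (k0 + i))%N; elim: i => [|i IH].
  by rewrite addn0 expr0 divr1.
rewrite !addnS exp_termS.
apply: l1_bounded_weaken (l1_boundedZ _ (l1_bounded_generator IH)); first by [].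
have b0 : 0 <= b' / 2%:R ^+ i by apply: l1_bounded_ge0 IH.
rewrite ger0_norm ?invr_ge0 ?ler0n // [X in X <= _]mulrA.
apply: le_trans (ler_wpM2r b0 (ratio_le_half (leq_addr i k0))) _.
by rewrite exprS invfM mulrCA.
Qed.

Lemma displacement_partial_tail phi :
  exists (k0 : nat) (b : C), forall i n (s : seq 'X_{1..N}), uniq s ->
  \sum_(m <- s) `|coeff m (displacement_partial (-1) j phi (k0 + i + n)
                  - displacement_partial (-1) j phi (k0 + i))| <= b / 2%:R ^+ i.
Proof.
have [k0 [b hb]] := exp_term_geometric phi; exists k0, (b * 2%:R) => i n s us.
have b0 : 0 <= b by have [d /l1_bounded_ge0] := hb 0; rewrite expr0 divr1.
(* The exact sum of the [n] geometric bounds makes the induction on [n] close. *)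
suff : \sum_(m <- s) `|coeff m (displacement_partial (-1) j phi (k0 + i + n)
                  - displacement_partial (-1) j phi (k0 + i))|
   <= b * 2%:R / 2%:R ^+ i - b * 2%:R / 2%:R ^+ (i + n).
  move=> h; apply: le_trans h _; rewrite lerBlDr lerDl.
  by rewrite divr_ge0 ?exprn_ge0 ?mulr_ge0 ?ler0n.
elim: n => [|n IH].
  rewrite !addn0 !subrr big1 // => m _; by rewrite coeff0 normr0.
have [d [_ /(_ s us) ht]] := hb (i + n)%N; rewrite addnA in ht.
have -> : b * 2%:R / 2%:R ^+ i - b * 2%:R / 2%:R ^+ (i + n.+1) =
  (b * 2%:R / 2%:R ^+ i - b * 2%:R / 2%:R ^+ (i + n)) + b / 2%:R ^+ (i + n).
  rewrite addnS [2%:R ^+ _.+1]exprS invfM.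
  have : 2%:R ^+ (i + n) != 0 :> C by rewrite expf_neq0 // pnatr_eq0.
  have : 2%:R ^+ i != 0 :> C by rewrite expf_neq0 // pnatr_eq0.
  move: (2%:R ^+ i) (2%:R ^+ (i + n)) => x y x0 y0; field.
  by rewrite x0 y0.
apply: le_trans (lerD IH ht); rewrite -big_split; apply: ler_sum => m _.
by rewrite addnS displacement_partialS addrAC [X in `|X| <= _]coeffD ler_normD.
Qed.

End ExponentialBounds.

(** * Limits of real and complex sequences *)

Section ComplexLimits.
Variable R : realType.
Local Notation C := R[i].

Definition converges_to (F : numDomainType) (u : nat -> F) (z : F) :=
  forall e : F, 0 < e -> exists K0, forall K, (K0 <= K)%N -> `|u K - z| <= e.

(** The limit is the supremum of the set [E] of eventual lower bounds of [u]. *)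
Lemma real_cauchy_converges (u : nat -> R) :
  (forall e : R, 0 < e -> exists K0, forall K n, (K0 <= K)%N ->
     `|u (K + n)%N - u K| <= e) ->
  exists z, converges_to u z.
Proof.
move=> uC; pose E : classical_sets.set R :=
  fun x => exists K0, forall K, (K0 <= K)%N -> x <= u K.
have E1 e K0 : (forall n, `|u (K0 + n)%N - u K0| <= e) -> E (u K0 - e).
  move=> h; exists K0 => K /subnKC <-; have := h (K - K0)%N.
  by rewrite ler_distl => /andP[].
have E2 e K0 : (forall n, `|u (K0 + n)%N - u K0| <= e) ->
    classical_sets.ubound E (u K0 + e).
  move=> h x [K1 xu]; apply: le_trans (xu (K0 + K1)%N (leq_addl _ _)) _.
  by have := h K1; rewrite ler_distl => /andP[].
exists (sup E) => e /uC[K0 h]; exists K0 => K KK.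
have hK n := h K n KK.
rewrite ler_distlC; apply/andP; split.
  by apply: ub_le_sup; [exists (u K + e); apply: E2 | apply: E1].
by apply: ge_sup; [exists (u K - e); apply: E1 | apply: E2].
Qed.

Lemma normc_real (x : R) : `|x%:C%C| = `|x|%:C%C :> C.
Proof. by rewrite normc_def /= expr0n addr0 sqrtr_sqr. Qed.

Lemma normc_ge_Im (x : C) : `|complex.Im x|%:C%C <= `|x|.
Proof.
have := normc_ge_Re (x * 'i%C); rewrite ReiNIm normrN normrM.
by rewrite [`|'i%C|]normc_def /= expr0n expr1n add0r sqrtr1 mulr1.
Qed.

Lemma gt0_complexE (e : C) : 0 < e -> exists2 r : R, 0 < r & e = r%:C%C.
Proof.
move=> e0; exists (complex.Re e); last by rewrite RRe_real ?gtr0_real.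
by move: e0; rewrite ltcE => /andP[].
Qed.

Lemma complex_cauchy_converges (u : nat -> C) :
  (forall e : C, 0 < e -> exists K0, forall K n, (K0 <= K)%N ->
     `|u (K + n)%N - u K| <= e) ->
  exists z, converges_to u z.
Proof.
move=> uC.
have ReB (x y : C) : complex.Re (x - y) = complex.Re x - complex.Re y.
  by case: x; case: y.
have ImB (x y : C) : complex.Im (x - y) = complex.Im x - complex.Im y.
  by case: x; case: y.
have [|a ha] := @real_cauchy_converges (fun K => complex.Re (u K)).
  move=> e e0; have [|K0 h] := uC e%:C%C; first by rewrite ltcR.
  exists K0 => K n KK; have hK := h K n KK; rewrite -lecR -ReB.
  exact: le_trans (normc_ge_Re _) hK.
have [|b hb] := @real_cauchy_converges (fun K => complex.Im (u K)).
  move=> e e0; have [|K0 h] := uC e%:C%C; first by rewrite ltcR.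
  exists K0 => K n KK; have hK := h K n KK; rewrite -lecR -ImB.
  exact: le_trans (normc_ge_Im _) hK.
exists (a +i* b)%C => e /gt0_complexE[r r0 ->].
have r20 : 0 < r / 2%:R by rewrite divr_gt0 ?ltr0n.
have [K1 h1] := ha _ r20; have [K2 h2] := hb _ r20.
exists (maxn K1 K2) => K; rewrite geq_max => /andP[/h1 k1 /h2 k2].
rewrite [u K - _]complexE ReB ImB; apply: le_trans (ler_normD _ _) _.
rewrite normrM [`|'i%C|]normc_def /= expr0n expr1n add0r sqrtr1 mul1r.
rewrite !normc_real -rmorphD lecR /=.
by apply: le_trans (lerD k1 k2) _; rewrite -splitr.
Qed.

Lemma complex_archi (x : C) : 0 <= x -> exists n : nat, x <= n%:R.
Proof.
move=> x0; exists (Num.bound (complex.Re x)).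
rewrite -(RRe_real (ger0_real x0)) -(rmorph_nat (real_complex R)) lecR /=.
apply/ltW/archi_boundP; move: x0; rewrite lecE => /andP[_]; exact.
Qed.

Lemma small_geometric (b e : C) : 0 <= b -> 0 < e -> exists i, b / 2%:R ^+ i <= e.
Proof.
move=> b0 e0; have [|n hn] := complex_archi (x := b / e).
  by rewrite divr_ge0 // ltW.
exists n; rewrite ler_pdivrMr ?exprn_gt0 ?ltr0n // -ler_pdivrMl // mulrC.
apply: le_trans hn _; rewrite -natrX ler_nat.
by apply/ltnW/ltn_expl.
Qed.

Lemma converges_to_unique (u : nat -> C) (z z' : C) :
  converges_to u z -> converges_to u z' -> z = z'.
Proof.
move=> uz uz'; apply/eqP; rewrite -subr_eq0; apply: contraT => d0.
have e0 : 0 < `|z - z'| / 3%:R by rewrite divr_gt0 ?normr_gt0 ?ltr0n.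
have [K h] := uz _ e0; have [K' h'] := uz' _ e0.
have := le_trans (ler_distD (u (K + K')%N) z z')
  (lerD (eq_ind _ (fun x => x <= _) (h _ (leq_addr K' K)) _ (distrC _ _))
        (h' _ (leq_addl K K'))).
have -> : `|z - z'| / 3%:R + `|z - z'| / 3%:R = `|z - z'| * (2%:R / 3%:R).
  by field.
rewrite -{1}[`|z - z'|]mulr1 ler_pM2l ?normr_gt0 // ler_pdivlMr ?ltr0n //.
by rewrite mul1r ler_nat.
Qed.

Lemma converges_toZ (a : C) (u : nat -> C) (z : C) :
  converges_to u z -> converges_to (fun K => a * u K) (a * z).
Proof.
(* Adding 1 keeps the divisor positive when [a] is 0. *)
move=> uz e e0; have a1 : 0 < `|a| + 1 by rewrite ltr_wpDl.
have [|K h] := uz (e / (`|a| + 1)); first by rewrite divr_gt0.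
exists K => K' /h hK; rewrite -mulrBr normrM.
apply: le_trans (ler_wpM2l (normr_ge0 a) hK) _.
rewrite mulrCA ger_pMr // ler_pdivrMr // mul1r lerDl //.
Qed.

Lemma converges_to_shift d (u v : nat -> C) (z : C) : (forall K, v (d + K)%N = u K) ->
  converges_to u z -> converges_to v z.
Proof.
move=> vu uz e /uz[K h]; exists (d + K)%N => K' dK.
have dK' : (d <= K')%N by apply: leq_trans dK; apply: leq_addr.
by rewrite -(subnKC dK') vu; apply: h; rewrite leq_subRL.
Qed.

Lemma converges_to_sum (I : eqType) (s : seq I) (u : I -> nat -> C)
    (z : I -> C) (e : C) :
  (forall i, converges_to (u i) (z i)) -> 0 < e ->
  exists K0, forall K, (K0 <= K)%N -> \sum_(i <- s) `|u i K - z i| <= e.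
Proof.
move=> uz; elim: s e => [|i s IH] e e0.
  by exists 0 => K _; rewrite big_nil ltW.
have e20 : 0 < e / 2%:R by rewrite divr_gt0 ?ltr0n.
have [K1 h1] := IH _ e20; have [K2 h2] := uz i _ e20.
exists (maxn K1 K2) => K; rewrite geq_max => /andP[/h1 k1 /h2 k2].
by rewrite big_cons [e]splitr lerD.
Qed.

Lemma sum_sqr_le (I : eqType) (s : seq I) (x : I -> C) :
  (forall i, 0 <= x i) -> \sum_(i <- s) x i <= 1 ->
  \sum_(i <- s) x i ^+ 2 <= \sum_(i <- s) x i.
Proof.
move=> x0; elim: s => [|i s IH]; first by rewrite !big_nil.
rewrite !big_cons => h; have s0 : 0 <= \sum_(j <- s) x j by apply: sumr_ge0.
apply: lerD; last by apply/IH/(le_trans _ h); rewrite lerDr.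
by rewrite expr2 -[leRHS]mulr1 ler_wpM2l // (le_trans _ h) // lerDl.
Qed.

End ComplexLimits.

Lemma insert_mode_inj N (j : 'I_N.+1) k m n :
  (insert_mode j k m == insert_mode j k n) = (m == n).
Proof.
apply/eqP/eqP => [/mnmP h|->//]; apply/mnmP => i.
by have := h (fintype.lift j i); rewrite !insert_mode_lift.
Qed.

(** * Existence and vacuum projection of displaced states *)

Section Displacement.
Variable R : realType.
Local Notation C := R[i].

Lemma displacement_partial_cauchy N (j : 'I_N) (phi : fock C N) (e : C) : 0 < e ->
  exists K0, forall K n (s : seq 'X_{1..N}), (K0 <= K)%N -> uniq s ->
  \sum_(m <- s) `|coeff m (displacement_partial (-1) j phi (K + n)
                  - displacement_partial (-1) j phi K)| <= e.
Proof.
move=> e0; have [k0 [b hb]] := displacement_partial_tail j phi.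
have b0 : 0 <= b by have := hb 0%N 0%N [::] isT; rewrite big_nil expr0 divr1.
have [i hi] := small_geometric b0 e0; exists (k0 + i)%N => K n s KK us.
have [i' ii' ->] : exists2 i', (i <= i')%N & K = (k0 + i')%N.
  by exists (K - k0)%N; rewrite ?leq_subRL ?subnKC // (leq_trans _ KK) ?leq_addr.
apply: le_trans (hb i' n s us) (le_trans _ hi); apply: ler_wpM2l => //.
by rewrite lef_pV2 ?posrE ?exprn_gt0 ?ltr0n // -!natrX ler_nat leq_pexp2l.
Qed.

(** The limit is taken amplitude by amplitude; the Cauchy bound, uniform over finite sets of
    amplitudes, then upgrades it to norm convergence. *)
Lemma displaced_exists N (j : 'I_N) (phi : fock C N) :
  exists chi, is_displaced (-1) j phi chi.
Proof.
have [m|chi hchi] := @boolp.choice _ _ (fun (m : 'X_{1..N}) z =>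
  converges_to (fun K => coeff m (displacement_partial (-1) j phi K)) z).
  apply: complex_cauchy_converges => e e0.
  have [K0 h] := displacement_partial_cauchy j phi e0; exists K0 => K n KK.
  by have := h K n [:: m] KK isT; rewrite big_seq1 coeffB.
(* [d] is below [e] and also below 1, so that squares are dominated by absolute values. *)
exists chi => e e0; pose d := e / (1 + e).
have e1 : 0 < 1 + e by rewrite addr_gt0.
have d0 : 0 < d / 2%:R by rewrite !divr_gt0 ?ltr0n.
have [K0 h] := displacement_partial_cauchy j phi d0; exists K0 => K KK s us.
have sd : \sum_(n <- s) `|coeff n (displacement_partial (-1) j phi K) - chi n| <= d.
  (* [K1] depends on [s], but it only serves to pass to the limit; the threshold [K0] does not
     depend on [s]. *)
  have [K1 hK1] := converges_to_sum s hchi d0.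
  have := lerD (h K K1 s KK us) (hK1 (K + K1)%N (leq_addl _ _)).
  rewrite -splitr -big_split; apply: le_trans; apply: ler_sum => n _ /=.
  rewrite coeffB [`|coeff n _ - coeff n _|]distrC.
  exact: ler_distD.
apply: le_trans (sum_sqr_le _ _) _ => [i //||].
  by apply: le_trans sd _; rewrite ler_pdivrMr // mul1r lerDr.
apply: le_trans sd _; rewrite ler_pdivrMr // ler_peMr ?(ltW e0) // lerDl.
exact: ltW.
Qed.

Lemma displaced_converges N (j : 'I_N) (phi : fock C N) beta chi m :
  is_displaced beta j phi chi ->
  converges_to (fun K => coeff m (displacement_partial beta j phi K)) (chi m).
Proof.
move=> h e e0; have [|K0 hK] := h (e ^+ 2); first by rewrite exprn_gt0.
exists K0 => K /hK /(_ [:: m] isT); rewrite big_seq1.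
by rewrite ler_sqr ?nnegrE // ltW.
Qed.

(** Displacing the vacuum of one mode shows convergence; the lower bound [1/3] on the partial sums
    excludes the limit 0. *)
Lemma vacuum_amplitude_converges :
  exists2 k : C, k != 0 & converges_to (@vacuum_amplitude C) k.
Proof.
have [chi hchi] := displaced_exists ord0 (vacuum C 1).
have hk : converges_to (@vacuum_amplitude C) (chi 0%MM).
  move=> e e0; have [K0 h] := displaced_converges 0%MM hchi e0.
  exists K0 => K /h; rewrite coeff_partialU ?mnm0E // eqxx mulr1; exact.
exists (chi 0%MM) => //; apply/eqP => k0; rewrite k0 in hk.
have [|K h] := hk (4%:R^-1); first by rewrite invr_gt0 ltr0n.
have := le_trans (vacuum_amplitude_ge C K) (eq_ind _ (fun x => `|x| <= _)
  (h K.+2 (leq_trans (leqnSn _) (leqnSn _))) _ (subr0 _)).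
by rewrite lef_pV2 ?posrE ?ltr0n // ler_nat.
Qed.

(* The vacuum amplitude of [D(-1)] on mode [j] evaluates the creation operator
   of that mode at 1, up to the common factor [<0|D(-1)|0>]. *)
Lemma displaced_evaluation : exists2 k : C, k != 0 &
  forall M (psi : fock C M) (d : 'X_{1..M} -> nat) (c : C), exists2 chi,
  is_displaced (-1) ord0 (c *: \sum_(m <- dom psi) coeff m psi *:
     iter (d m) (creation ord0) << insert_mode ord0 0 m >>) chi
  & forall m, chi (insert_mode ord0 0 m) = c * k * coeff m psi.
Proof.
have [k k0 hk] := vacuum_amplitude_converges; exists k => // M psi d c.
set Phi := c *: _; have [chi hchi] := displaced_exists ord0 Phi.
exists chi => // m; apply: converges_to_unique (displaced_converges _ hchi) _.
have -> : c * k * coeff m psi = c * coeff m psi * k by rewrite mulrAC.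
have insj (n : 'X_{1..M}) : insert_mode ord0 0 n ord0 = 0%N by rewrite insert_mode_at.
(* [D] dominates all the powers [d n] in the support, so a series of [D + K] terms can absorb each
   of them. *)
pose D := (\max_(n <- dom psi) d n + d m)%N.
have hD n : n \in dom psi -> (d n <= D)%N.
  by move=> nd; rewrite /D (leq_trans _ (leq_addr _ _)) // leq_bigmax_seq.
apply: (@converges_to_shift _ D
  (fun K => c * coeff m psi * vacuum_amplitude C (D - d m + K)%N)).
  move=> K; have SL := @displacement_partial_linear C M.+1 ord0 (D + K).
  pose S (phi : fock C M.+1) := displacement_partial (-1) ord0 phi (D + K).
  have S0 : S 0 = 0 by have := SL (-1) 0 0; rewrite /S scaler0 addr0 scaleN1r addNr.
  have SZ a x : S (a *: x) = a *: S x.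
    by have := SL a x 0; rewrite /= -/(S 0) S0 !addr0.
  have SD x y : S (x + y) = S x + S y.
    by have := SL 1 x y; rewrite /= !scale1r.
  rewrite /= -[displacement_partial _ _ _ _]/(S Phi) SZ coeffZ -mulrA; congr (_ * _).
  rewrite (big_morph S SD S0) raddf_sum /=.
  (* Removing the [d n] creations uses up [d n] terms of the series; the remaining basis vector has
     an amplitude only for [n = m]. *)
  have E n : n \in dom psi -> coeff (insert_mode ord0 0 m) (S (coeff n psi *:
      iter (d n) (creation ord0) << insert_mode ord0 0 n >>)) =
      coeff n psi * (vacuum_amplitude C (D - d n + K) * (n == m)%:R).
    move=> nd; rewrite SZ coeffZ /S; congr (_ * _).
    rewrite -{1}(subnKC (hD n nd)) -addnA coeff_partial_creations //.
    by rewrite coeff_partialU // insert_mode_inj.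
  rewrite (eq_big_seq _ E); have [md|md] := boolP (m \in dom psi); last first.
    rewrite coeff_outdom // mul0r big_seq big1 // => n nd.
    by case: eqP nd md => [->->|_ _ _] //; rewrite !mulr0.
  rewrite (bigD1_seq m) ?uniq_dom //= eqxx mulr1 addnBAC ?hD // big1 ?addr0 //.
  by move=> n /negPf ->; rewrite !mulr0.
apply: converges_toZ => e /hk[K0 h]; exists K0 => K KK.
by apply: h; apply: leq_trans KK _; apply: leq_addl.
Qed.

End Displacement.

(** * Homogenized stellar polynomials as Fock states *)

Section Homogenization.
Variable C : numClosedFieldType.

Lemma dom_stellar M (psi : fock C M) : perm_eq (dom psi) (msupp (stellar psi)).
Proof.
apply: uniq_perm; rewrite ?uniq_dom ?msupp_uniq // => m.
rewrite mem_dom mcoeff_msupp coeff_stellar mulf_eq0 invr_eq0.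
by rewrite (negPf (sqrtC_mfact_neq0 C m)) orbF.
Qed.

(** The missing degree of each monomial is supplied by unnormalized creations in mode 0, which is
    the shape of state that [displaced_evaluation] evaluates at 1. *)
Lemma stellar_homogenization M (psi : fock C M) :
  stellar (\sum_(m <- dom psi) coeff m psi *:
     iter ((msize (stellar psi)).-1 - mdeg m) (creation ord0)
       << insert_mode ord0 0 m >>) =
  homogenization (stellar psi).
Proof.
rewrite /homogenization -(perm_big _ (dom_stellar psi)) raddf_sum.
apply: eq_bigr => m _ /=; rewrite linearZ /= coeff_stellar -scalerA.
congr (_ *: _); elim: (_ - _)%N => [|k IH] /=.
  by rewrite stellarU mfact_insert mul1r.
by rewrite stellar_creation IH -scalerAr !mpolyX_insert exprS mulrA.
Qed.

End Homogenization.

Theorem corollary3 (R : realType) (M : nat) (psi : fock R[i] M)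
    (B : 'M[R[i]]_(M.+1)) :
  msize (stellar psi) = 3%N ->
  B^T = B ->
  homogenization (stellar psi) = quadratic_form B ->
  (stellar psi \is homog mdeg ->
     exists l : nat,
       single_ancilla_protocol (\rank B - 2) l psi /\
       (forall n' l' : nat, single_ancilla_protocol n' l' psi -> (l <= l')%N))
  /\
  (stellar psi \isn't homog mdeg ->
     exists l : nat, displaced_protocol (\rank B - 2) l psi).
Proof.
(* A quadratic polynomial takes at least two additions and the shift needs two forms; for rank 1 the
   truncated [\rank B - 2] is 0, which agrees with [r - 2]. *)
move=> psi3 Bs psiB; set r := maxn (\rank B) 2.
have r1 : (1 < r)%N by rewrite leq_maxr.
have rB : (\rank B <= r)%N by rewrite leq_maxl.
have -> : (\rank B - 2 = r - 2)%N by rewrite /r; lia.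
split=> [psih|_]; exists r.
  (* [B0] is the block of [B] on the target variables. In the homogeneous case [B] is recovered from
     it, so the rank bounds pass in both directions. *)
  pose W := shift_mx R[i] M; pose B0 := W *m B *m W^T.
  have EW := homogenization_homog psih.
  have psiB0 : stellar psi = quadratic_form B0.
    rewrite -(subst1 (stellar psi)) -(shift_mxK R[i] M) -substM -EW psiB.
    by rewrite subst_quadratic_form trmxK.
  have B0s : B0^T = B0 by rewrite /B0 !trmx_mul trmxK Bs mulmxA.
  have BB0 : B = W^T *m B0 *m W.
    apply: quadratic_form_sym_inj => //.
      by rewrite trmx_mul (trmx_mul _ B0) trmxK B0s mulmxA.
    by rewrite -subst_quadratic_form -psiB0 -EW psiB.
  have rB0 : (\rank B0 <= \rank B)%N.
    by apply: leq_trans (mxrankM_maxl _ _) (mxrankM_maxr _ _).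
  split.
    exact: (preparable_quadratic_form r1 B0s (leq_trans rB0 rB) psiB0).
  have psi0 : stellar psi != 0 by rewrite -msize_poly_eq0 psi3.
  have psi2 : stellar psi \is 2.-homog by rewrite homog_msize psi3 in psih.
  (* The two arguments of the maximum are bounded separately: [l = n + 2] gives the 2, and the rank
     bound for [B0] gives the rank of [B]. *)
  move=> n l /(single_ancilla_length B0s psiB0 psi0 psi2)[ln lB].
  rewrite geq_max ln ltnS andbT -ln; apply: leq_trans lB.
  by rewrite {1}BB0; apply: leq_trans (mxrankM_maxl _ _) (mxrankM_maxr _ _).
(* The homogenization is prepared as a state of [M.+1] modes, whose mode 0 carries the homogenizing
   variable and is displaced afterwards. *)
have [phi [c [pphi c0 Ephi]]] := preparable_quadratic_form r1 Bs rB
  (etrans (stellar_homogenization psi) psiB).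
have [k k0 hk] := displaced_evaluation R.
have [chi hchi Echi] := hk M psi (fun m => (msize (stellar psi)).-1 - mdeg m)%N c.
rewrite -Ephi in hchi; exists phi, (-1), chi, (c * k).
by split; [exact: pphi | exact: hchi | rewrite mulf_neq0 | exact: Echi].
Qed.
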